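(* Let $K$ be a field with $\operatorname{char}K=p>0$, and let $G=G(n,p^r)$ where $p\nmid n$, $s=[\mathbb{F}_p(\zeta_n^2):\mathbb{F}_p]$ divides $r$, and $r\ge 1$. Then $\operatorname{ed}_K(G)=1$ if and only if $n$ is odd, $\zeta_n\in K$, and $[K:\mathbb{F}_p]\ge r$.
   Context: Essential dimension: for a finite group $G$ and a field $K$, choose a faithful finite-dimensional representation $G\to GL(V)$ over $K$ and let $K(V)$ be the field of rational functions on $V$ with the induced $G$-action. A faithful $G$-subfield is a subfield $E$ with $K\subseteq E\subseteq K(V)$, stable under $G$, on which $G$ acts faithfully. Then $\operatorname{ed}_K(G)$ is the minimum of $\operatorname{trdeg}_K E$ over all faithful $G$-subfields $E$; it is independent of $V$. $[K:\mathbb{F}_p]$ may be infinite. The group $G(n,p^r)$: $\zeta_n$ is a primitive $n$-th root of unity in an algebraic closure of $\mathbb{F}_p$ (resp. of $K$). Let $W$ be an $\mathbb{F}_p(\zeta_n^2)$-vector space of dimension $r/s$. Then $G(n,p^r)=W\rtimes\langle\tau\rangle$, where $\tau$ has order $n$ and acts on $W$ by $w\mapsto\zeta_n^2w$. Equivalently, for an algebraically closed field $L$ of characteristic $p$, it is isomorphic to the subgroup of $SL_2(L)$ generated by $\begin{pmatrix}1&v\\0&1\end{pmatrix}$, $v\in V$, and $\begin{pmatrix}\zeta_n&0\\0&\zeta_n^{-1}\end{pmatrix}$, where $V\subset L$ is any $\mathbb{F}_p(\zeta_n^2)$-subspace with $\dim_{\mathbb{F}_p}V=r$; the isomorphism type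 does not depend on these choices. *)

(* Defs.v *)
From HB Require Import structures.
From mathcomp Require Import all_boot all_order all_algebra all_fingroup.
From mathcomp Require Import mxrepresentation.
From mathcomp Require Import generic_quotient fraction.
From mathcomp.multinomials Require Import mpoly.

Set Implicit Arguments.
Unset Strict Implicit.
Unset Printing Implicit Defensive.

Import GRing.Theory.
Local Open Scope ring_scope.

Definition Fp_free (L : fieldType) (p k : nat) (x : 'I_k -> L) : Prop :=
  forall c : 'I_k -> nat, (forall i, (c i < p)%N) ->
    \sum_(i < k) (c i)%:R * x i = 0 -> forall i, c i = 0%N.

(* [F_p(w) : F_p] = s : the powers 1, w, ..., w^(s-1) form an F_p-basis of
   F_p(w) = F_p[w], i.e. they are F_p-independent and w^s lies in their
   F_p-span. *)
Definition Fp_degree (L : fieldType) (p : nat) (w : L) (s : nat) : Prop :=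
  Fp_free p (fun i : 'I_s => w ^+ i) /\
  exists c : 'I_s -> nat, w ^+ s = \sum_(i < s) (c i)%:R * w ^+ i.

Definition Fp_dim_ge (K : fieldType) (p r : nat) : Prop :=
  exists x : 'I_r -> K, Fp_free p x.

(* The group G(n, p^r), via its model inside SL_2(L), L algebraically
   closed of characteristic p: G is isomorphic (through the injective
   homomorphism f) to the subgroup of SL_2(L) generated by the matrices
   [[1, v], [0, 1]] (v in V) and diag(z, z^-1), where z is a primitive
   n-th root of unity and V is an F_p(z^2)-subspace of L with
   dim_{F_p} V = r, i.e. #|V| = p^r.  V is given by the duplicate-free
   list of its elements; a finite additive submonoid of L is an additive
   subgroup (char p), and closure under multiplication by z^2 makes it an
   F_p[z^2] = F_p(z^2)-subspace. *)

Definition unipmx (L : fieldType) (v : L) : 'M[L]_2 :=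
  \matrix_(i < 2, j < 2) (if (i == j) then 1 else if (i < j)%N then v else 0).

Definition diagmx (L : fieldType) (z : L) : 'M[L]_2 :=
  \matrix_(i < 2, j < 2) (if (i == j) then (if i == 0 :> nat then z else z^-1) else 0).

Definition is_Gnpr (gT : finGroupType) (G : {group gT}) (p n r : nat) : Prop :=
  exists (L : closedFieldType) (z : L) (V : seq L) (f : gT -> 'M[L]_2),
    [/\ p \in [pchar L], n.-primitive_root z,
        [/\ uniq V, 0 \in V, ({in V &, forall a b, a + b \in V}),
            ({in V, forall a, z ^+ 2 * a \in V}) & size V = (p ^ r)%N],
        ({in G &, injective f} /\ (forall x y, x \in G -> y \in G -> f (x * y)%g = f x *m f y))
      & ((forall v, v \in V -> exists2 x, x \in G & f x = unipmx v) /\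
         (exists2 x, x \in G & f x = diagmx z) /\ (G :=: <<[set x in G | has (fun v => f x == unipmx v) V
                              || (f x == diagmx z)]>>)%g)].

(* Essential dimension.  For a representation rG : G -> GL_d(K) (row
   vector convention, v |-> v *m rG g), K(V) is the field of fractions of
   the polynomial ring K[x_0, ..., x_{d-1}], where x_i is the i-th
   coordinate function.  g acts by (g.F)(v) = F(v *m rG g^-1), i.e. by the
   K-algebra substitution x_i |-> \sum_j (rG g^-1) j i * x_j. *)

Definition KV (K : fieldType) (d : nat) := {fraction {mpoly K[d]}}.

Definition tofracKV (K : fieldType) (d : nat) (q : {mpoly K[d]}) : KV K d :=
  @FracField.tofrac _ q.

Definition constKV (K : fieldType) (d : nat) (c : K) : KV K d :=
  tofracKV (c%:MP).

Definition gsubst (K : fieldType) (gT : finGroupType) (G : {group gT}) (d : nat)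
  (rG : mx_representation K G d) (g : gT) (q : {mpoly K[d]}) : {mpoly K[d]} :=
  q \mPo [tuple \sum_(j < d) (rG (g^-1)%g j i) *: 'X_j | i < d].

Definition gact (K : fieldType) (gT : finGroupType) (G : {group gT}) (d : nat)
  (rG : mx_representation K G d) (g : gT) (F : KV K d) : KV K d :=
  let q := repr F in
  tofracKV (gsubst rG g \n_q) / tofracKV (gsubst rG g \d_q).

Definition is_subfield (K : fieldType) (d : nat) (E : KV K d -> Prop) : Prop :=
  [/\ forall c : K, E (constKV d c),
      forall x y, E x -> E y -> E (x + y),
      forall x, E x -> E (- x),
      forall x y, E x -> E y -> E (x * y)
    & forall x, E x -> E (x^-1)].

Definition faithful_Gsubfield (K : fieldType) (gT : finGroupType) (G : {group gT})
  (d : nat) (rG : mx_representation K G d) (E : KV K d -> Prop) : Prop :=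
  [/\ is_subfield E,
      forall g x, g \in G -> E x -> E (gact rG g x)
    & forall g, g \in G -> g != 1%g -> exists2 x, E x & gact rG g x != x].

Definition trdeg_le (K : fieldType) (d : nat) (E : KV K d -> Prop) (t : nat) : Prop :=
  forall e : 'I_t.+1 -> KV K d, (forall i, E (e i)) ->
    exists2 Q : {mpoly K[t.+1]}, Q != 0 & mmap (@constKV K d) e Q = 0.

Definition ed_eq (K : fieldType) (gT : finGroupType) (G : {group gT}) (d : nat)
  (rG : mx_representation K G d) (m : nat) : Prop :=
  (exists2 E, faithful_Gsubfield rG E & trdeg_le E m) /\
  (forall E t, faithful_Gsubfield rG E -> trdeg_le E t -> (m <= t)%N).

(* Main.v *)
(** An element of [K(V)] algebraic over [K] is constant, so a faithful [G]-subfield has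
    transcendence degree at least 1.

    Suppose [E] is a faithful [G]-subfield of transcendence degree 1, for a representation in which
    a chosen [w] of order [p] is unitriangular. A Kronecker substitution [x_i |-> x^(N^i)] embeds
    a faithful [G]-stable subfield of [E] into [K(x)], so by Lueroth that subfield is [K(t)], and
    [G] acts on [t] by Moebius transformations. The matrix of [w] has a scalar [p]-th power which
    is a norm from [K(V)]; as [w] preserves leading coefficients this norm is a [p]-th power in
    [K]. Hence [w] is unipotent with a [K]-rational fixed point, and one may take
    [w t = t + 1]. Then [W] acts by translations, which embeds [W] into [K], and [tau] acts by
    [t |-> a t + b] with [a] of order [n] in [K^*]; if [n] were even, [tau^(n/2)] would commute
    with [w], forcing [a^(n/2) = 1].

    Conversely, choose [y] in [K] with the same minimal polynomial over [F_p] as [zeta^2] and an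
    injective additive map [j : W -> K] with [j (zeta^2 v) = y j(v)]. This turns [G] into a group of
    affine transformations [x |-> chi x + m] of [K], and for any [theta] of nonzero trace the
    function [f = (sum_g m(g^-1) g theta) / (sum_g g theta)] satisfies [h f = chi(h) f + m(h)],
    so that [K(f)] is the required subfield. *)

Require Import Defs.
From HB Require Import structures.
From mathcomp Require Import all_boot all_order all_algebra all_fingroup all_field.
From mathcomp Require Import mxrepresentation.
From mathcomp Require Import generic_quotient fraction.
From mathcomp.multinomials Require Import mpoly.
From mathcomp Require Import ring zify.
From Stdlib Require Import Classical.

Set Implicit Arguments.
Unset Strict Implicit.
Unset Printing Implicit Defensive.

Import Order.TTheory GRing.Theory.
Local Open Scope ring_scope.

(** * Fields of fractions and subfields *)

(** Over an imperfect [K] an element of order [p] of [PGL_2(K)] need not have a [K]-rational fixed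
    point: in characteristic 2, with [a] not a square, [t |-> a / t] has none. Excluding this is the
    purpose of the norm argument, and it uses the freedom to choose the representation: the forward
    direction works with one conjugate of the regular representation, adapted to [w]. The Kronecker
    substitution is defined only on fractions whose denominator survives it. Hence [N] is fixed
    after finitely many witnesses of faithfulness, and only part of [E] is embedded; that part is a
    field because transcendence degree 1 prevents a nonzero element of [E] from specializing to 0.
    In the converse, [L] and [K] share only the prime field, so [zeta^2] and [V] are carried to [K]
    through polynomials over [F_p]. Oddness of [n] makes [zeta^2] again of order [n], so that the
    affine action of [G] is faithful. *)

Section Fractions.
Variable R : idomainType.
Local Notation "x %:F" := (@FracField.tofrac R x).

Lemma fracE (x : {fraction R}) : x = (\n_(repr x))%:F / (\d_(repr x))%:F.
Proof.
have dn0 : (\d_(repr x))%:F != 0 by rewrite tofrac_eq0 denom_ratioP.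
apply: (mulIf dn0); rewrite divfK //.
rewrite -{1}[x]reprK; move: (repr x) {dn0} => y.
unlock FracField.tofrac; rewrite -[LHS]FracField.pi_mul.
apply/eqmodP; rewrite /= FracField.equivfE /FracField.mulf.
rewrite !numden_Ratio ?oner_neq0 ?mulr1 ?denom_ratioP //.
by rewrite mulrC.
Qed.

Lemma fracP (x : {fraction R}) : exists a b, b != 0 /\ x = a%:F / b%:F.
Proof.
by exists \n_(repr x), \d_(repr x); split; [exact: denom_ratioP|exact: fracE].
Qed.

Lemma frac_eq (a b c d : R) : b != 0 -> d != 0 ->
  a%:F / b%:F = c%:F / d%:F <-> a * d = c * b.
Proof.
move=> b0 d0; have b0' : b%:F != 0 by rewrite tofrac_eq0.
have d0' : d%:F != 0 by rewrite tofrac_eq0.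
split=> [/eqP|e].
  by rewrite eqr_div // -!tofracM tofrac_eq => /eqP.
by apply/eqP; rewrite eqr_div // -!tofracM tofrac_eq; apply/eqP.
Qed.

Section Extension.
Variables (F : fieldType) (s : {rmorphism R -> F}).

(** The formula is that of [gact], so that the action is convertible to an instance of this
    extension. *)
Definition frac_extension (x : {fraction R}) : F := s \n_(repr x) / s \d_(repr x).

(* [x] lies in the localization of [R] at the kernel of [s], where it takes the value [y]. *)
Definition spec (x : {fraction R}) (y : F) : Prop :=
  exists a b, [/\ s b != 0, x = a%:F / b%:F & y = s a / s b].

Lemma spec_neq0 b : s b != 0 -> b != 0.
Proof. by apply: contra_neq => ->; rewrite rmorph0. Qed.

Lemma spec_fun x y y' : spec x y -> spec x y' -> y = y'.
Proof.
move=> [a [b [b0 -> ->]]] [c [d [d0 e ->]]].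
move: e; rewrite frac_eq ?spec_neq0 // => e.
by apply/eqP; rewrite eqr_div // -!rmorphM e.
Qed.

Lemma specT a : spec a%:F (s a).
Proof. by exists a, 1; rewrite !rmorph1 !divr1 oner_neq0. Qed.

Lemma specD x y x' y' : spec x y -> spec x' y' -> spec (x + x') (y + y').
Proof.
move=> [a [b [b0 -> ->]]] [c [d [d0 -> ->]]].
exists (a * d + c * b), (b * d); rewrite rmorphM mulf_neq0 //; split=> //.
  by rewrite addf_div ?tofrac_eq0 ?spec_neq0 // -!tofracM -tofracD.
by rewrite addf_div // rmorphD !rmorphM.
Qed.

Lemma specN x y : spec x y -> spec (- x) (- y).
Proof.
move=> [a [b [b0 -> ->]]]; exists (- a), b; split=> //.
  by rewrite tofracN mulNr.
by rewrite rmorphN mulNr.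
Qed.

Lemma specM x y x' y' : spec x y -> spec x' y' -> spec (x * x') (y * y').
Proof.
move=> [a [b [b0 -> ->]]] [c [d [d0 -> ->]]].
exists (a * c), (b * d); rewrite !rmorphM mulf_neq0 //; split=> //.
  by rewrite mulf_div.
by rewrite mulf_div.
Qed.

Lemma specV x y : spec x y -> y != 0 -> spec x^-1 y^-1.
Proof.
move=> [a [b [b0 -> ->]]] n0; exists b, a; split; last 2 first.
- by rewrite invf_div.
- by rewrite invf_div.
by apply: contra_neq n0 => ->; rewrite mul0r.
Qed.

Hypothesis s_inj : forall a, s a = 0 -> a = 0.

Lemma frac_extension_spec x : spec x (frac_extension x).
Proof.
exists \n_(repr x), \d_(repr x); split=> //; last exact: fracE.
by apply/eqP => /s_inj /eqP; apply/negP; apply: denom_ratioP.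
Qed.

(** Both sides are values of the same fraction under [spec], which respects the operations and is
    single-valued; no representative has to be computed. *)
Lemma frac_extension_is_zmod_morphism : zmod_morphism frac_extension.
Proof.
move=> x y; apply: spec_fun (frac_extension_spec _) _.
by apply: specD; [|apply: specN]; apply: frac_extension_spec.
Qed.

Lemma frac_extension_is_monoid_morphism : monoid_morphism frac_extension.
Proof.
split=> [|x y]; apply: spec_fun (frac_extension_spec _) _.
  by rewrite -(rmorph1 s) -tofrac1; apply: specT.
by apply: specM; apply: frac_extension_spec.
Qed.

Lemma frac_extensionT a : frac_extension a%:F = s a.
Proof. exact: spec_fun (frac_extension_spec _) (specT _). Qed.

End Extension.
End Fractions.

Record subfield_closed (F : fieldType) (S : F -> Prop) : Prop := SubfieldClosed {
  sub1 : S 1;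
  subB : forall x y, S x -> S y -> S (x - y);
  subM : forall x y, S x -> S y -> S (x * y);
  subV : forall x, S x -> S x^-1 }.

Section SubTheory.
Variables (F : fieldType) (S : F -> Prop).
Hypothesis sS : subfield_closed S.

Lemma sub0 : S 0. Proof. by rewrite -(subrr 1); apply: subB => //; apply: sub1. Qed.
Lemma subN x : S x -> S (- x). Proof. by rewrite -sub0r => h; apply: subB => //; exact: sub0. Qed.
Lemma subD x y : S x -> S y -> S (x + y).
Proof. by move=> hx hy; rewrite -[y]opprK; apply: subB => //; apply: subN. Qed.
Lemma subdiv x y : S x -> S y -> S (x / y).
Proof. by move=> hx hy; apply: subM => //; apply: subV. Qed.
Lemma subX x n : S x -> S (x ^+ n).
Proof. by move=> hx; elim: n => [|n IH]; rewrite ?expr0 ?exprS; [exact: sub1|apply: subM]. Qed.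
Lemma sub_sum (I : Type) (r : seq I) (P : pred I) (G : I -> F) :
  (forall i, P i -> S (G i)) -> S (\sum_(i <- r | P i) G i).
Proof. by move=> h; apply: big_ind => //; [exact: sub0|exact: subD]. Qed.
Definition coefs_in (p : {poly F}) := forall i, S p`_i.

(** Long division only ever divides by the leading coefficient of [B], so it stays in the subfield;
    the induction cancels the leading term of [A]. *)
Lemma coefs_in_modp (A B : {poly F}) : B != 0 -> coefs_in A -> coefs_in B ->
  coefs_in (A %% B).
Proof.
move=> B0 hA hB; have [n] := ubnP (size A).
elim: n A hA => // n IH A hA; rewrite ltnS => sA.
have [ltAB|leBA] := ltnP (size A) (size B); first by rewrite modp_small.
pose q := (lead_coef A / lead_coef B)%:P * 'X^(size A - size B).
have A0 : A != 0.
  by apply: contraTneq leBA => ->; rewrite size_poly0 -ltnNge lt0n size_poly_eq0.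
have cq : lead_coef A / lead_coef B != 0 by rewrite mulf_neq0 ?invr_eq0 ?lead_coef_eq0.
have szqB : size (q * B) = size A.
  rewrite -mulrA mul_polyC size_scale // mulrC size_mulXn // subnK //.
have lcqB : lead_coef (q * B) = lead_coef A.
  by rewrite !lead_coefM lead_coefC lead_coefXn mulr1 divfK // lead_coef_eq0.
have -> : A %% B = (A - q * B) %% B by rewrite modpD modpN modp_mull oppr0 addr0.
apply: IH.
  move=> i; rewrite coefB; apply: subB => //.
  rewrite -mulrA coefCM coefXnM; apply: subM => //.
    by apply: subdiv => //; rewrite lead_coefE.
  by case: ifP => _ //; apply: sub0.
rewrite (leq_trans _ sA) //.
have sA0 : (0 < size A)%N by rewrite lt0n size_poly_eq0.
rewrite -(prednK sA0) ltnS; apply/leq_sizeP => j.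
rewrite leq_eqVlt => /orP[/eqP<-|lt].
  rewrite coefB -lead_coefE -szqB -lead_coefE lcqB subrr //.
by rewrite coefB !nth_default ?subr0 // ?szqB -(prednK sA0).
Qed.

Lemma sub_horner (p : {poly F}) x : coefs_in p -> S x -> S p.[x].
Proof.
move=> hp hx; rewrite horner_coef; apply: sub_sum => i _.
by apply: subM => //; apply: subX.
Qed.

End SubTheory.

(** * Simple extensions [K(f)] *)

Section RatGen.
Variables (K F : fieldType) (c : {rmorphism K -> F}).
Local Notation ev u f := (map_poly c u).[f].

Definition transc (f : F) := forall u : {poly K}, ev u f = 0 -> u = 0.

(** Membership of [e] in [K(f)]. The denominator has to be nonzero at [f], not merely as a
    polynomial, so the notion makes sense for algebraic [f] too. *)
Definition ratgen (f e : F) := exists u v : {poly K}, ev v f != 0 /\ e = ev u f / ev v f.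

Lemma ratgenC f a : ratgen f (c a).
Proof. by exists a%:P, 1; rewrite rmorph1 map_polyC !hornerE divr1 oner_neq0. Qed.

Lemma ratgen_self f : ratgen f f.
Proof. by exists 'X, 1; rewrite rmorph1 map_polyX !hornerE divr1 oner_neq0. Qed.

Lemma ratgen_sub f : subfield_closed (ratgen f).
Proof.
split.
- by rewrite -(rmorph1 c); apply: ratgenC.
- move=> _ _ [u [v [v0 ->]]] [u' [v' [v0' ->]]].
  exists (u * v' - u' * v), (v * v'); rewrite rmorphB !rmorphM hornerD hornerN !hornerM mulf_neq0 //; split=> //.
  by rewrite -mulNr addf_div // mulNr.
- move=> _ _ [u [v [v0 ->]]] [u' [v' [v0' ->]]].
  exists (u * u'), (v * v'); rewrite !rmorphM !hornerM mulf_neq0 //; split=> //.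
  by rewrite mulf_div.
move=> _ [u [v [v0 ->]]]; rewrite invf_div.
have [u0|u0] := eqVneq (ev u f) 0; last by exists v, u.
by exists 0, 1; rewrite u0 invr0 mulr0 rmorph0 rmorph1 horner0 hornerC mul0r oner_neq0.
Qed.

Lemma ratgen_min (S : F -> Prop) f e : subfield_closed S -> (forall a, S (c a)) -> S f ->
  ratgen f e -> S e.
Proof.
move=> sS cS Sf [u [v [_ ->]]].
by apply: (subdiv sS); apply: (sub_horner sS) => //; move=> i; rewrite coef_map; apply: cS.
Qed.

Lemma ratgen_trans f g e : ratgen f g -> ratgen g e -> ratgen f e.
Proof. by move=> fg; apply: ratgen_min => //; [exact: ratgen_sub|exact: ratgenC]. Qed.

Lemma ratgen_coprime f e : ratgen f e ->
  exists u v : {poly K}, [/\ coprimep u v, ev v f != 0 & e = ev u f / ev v f].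
Proof.
move=> [u [v [v0 ->]]].
have vn0 : v != 0 by apply: contra_neq v0 => ->; rewrite rmorph0 horner0.
pose g := gcdp u v; have g0 : g != 0 by rewrite gcdp_eq0 negb_and vn0 orbT.
have eu : u = (u %/ g) * g by rewrite divpK // dvdp_gcdl.
have hv : v = (v %/ g) * g by rewrite divpK // dvdp_gcdr.
exists (u %/ g), (v %/ g); split.
- by apply: coprimep_div_gcd; rewrite vn0 orbT.
- by apply: contra_neq v0; rewrite {2}hv rmorphM hornerM => ->; rewrite mul0r.
have g0' : ev g f != 0 by apply: contra_neq v0; rewrite hv rmorphM hornerM => ->; rewrite mulr0.
by rewrite {1}eu {1}hv !rmorphM !hornerM -mulf_div divff // mulr1.
Qed.

End RatGen.

(** * Lueroth's theorem *)

Lemma min_nat (P : nat -> Prop) : (exists n, P n) ->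
  exists2 n, P n & forall m, P m -> (n <= m)%N.
Proof.
move=> [n Pn]; have [k] := ubnP n; elim: k n Pn => // k IH n Pn; rewrite ltnS => nk.
have [[m [Pm mn]]|H] := classic (exists m, P m /\ (m < n)%N).
  by apply: (IH m) => //; apply: leq_trans mn nk.
by exists n => // m Pm; rewrite leqNgt; apply/negP => mn; apply: H; exists m.
Qed.

Lemma expr_div_clear (F : fieldType) (x y : F) i m : (i <= m)%N -> y != 0 ->
  (x / y) ^+ i * y ^+ m = x ^+ i * y ^+ (m - i).
Proof.
move=> im y0; rewrite expr_div_n -mulrA; congr (_ * _).
by rewrite -{1}(subnKC im) exprD mulKf // expf_neq0.
Qed.

Lemma scale_clear (F : fieldType) (p q : {poly F}) (b d n : F) : d != 0 ->
  q = b *: p -> d%:P * q * 'X + (b * n)%:P = (b * d) *: (p * 'X + (n / d)%:P).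
Proof.
move=> d0 ->; rewrite scalerDr mul_polyC scalerA -scalerAl [d * _]mulrC; congr (_ + _).
rewrite scale_polyC; congr (_%:P); rewrite -mulrA; congr (_ * _).
by rewrite mulrCA divff ?mulr1.
Qed.

Lemma clear_denoms (R : idomainType) (p : {poly {fraction R}}) :
  exists (b : R) (P : {poly R}), b != 0 /\
    map_poly (@FracField.tofrac R) P = FracField.tofrac b *: p.
Proof.
elim/poly_ind: p => [|p c [b [P [b0 e]]]].
  by exists 1, 0; rewrite oner_neq0 rmorph0 scaler0.
have [n [d [d0 ->]]] := fracP c.
exists (b * d), (d%:P * P * 'X + (b * n)%:P); rewrite mulf_neq0 //; split=> //.
have d0' : @FracField.tofrac R d != 0 by rewrite tofrac_eq0.
rewrite tofracM -(scale_clear _ d0' e) -tofracM.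
by rewrite rmorphD /= map_polyC rmorphM /= map_polyX rmorphM /= map_polyC.
Qed.

(** * Gauss's lemma for polynomials over [K[x]] *)

Section Gauss.
Variable K : fieldType.
Implicit Types (P Q R : {poly {poly K}}) (d a b : {poly K}).

Definition primitive P := forall d, (forall i, d %| P`_i) -> size d = 1%N.

Lemma irred_factor a : (1 < size a)%N -> exists2 d, irreducible_poly d & d %| a.
Proof.
have [n] := ubnP (size a); elim: n a => // n IH a; rewrite ltnS => sa a1.
have [irr|nirr] := classic (irreducible_poly a); first by exists a.
have [q [q1 qa nqa]] : exists q : {poly K}, [/\ size q != 1%N, q %| a & ~~ (q %= a)].
  apply: NNPP => H; apply: nirr; split=> // q q1 qa.
  by apply/negPn/negP => nqa; apply: H; exists q.
have a0 : a != 0 by rewrite -size_poly_gt0 (ltn_trans _ a1).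
have q0 : q != 0 by apply: contraNneq a0 => q0; move: qa; rewrite q0 dvd0p.
have sq : (size q < size a)%N.
  rewrite ltn_neqAle dvdp_leq // andbT; apply: contra nqa => /eqP e.
  by rewrite -dvdp_size_eqp // e.
have q1' : (1 < size q)%N.
  by rewrite ltn_neqAle eq_sym q1 lt0n size_poly_eq0.
have [d id dq] := IH q (leq_trans sq sa) q1'.
by exists d => //; apply: dvdp_trans qa.
Qed.

Lemma irred_dvdM d a b : irreducible_poly d -> d %| a * b -> (d %| a) || (d %| b).
Proof.
move=> id dab; have [//|nda] := boolP (d %| a).
by move: dab; rewrite Gauss_dvdpr // irreducible_poly_coprime.
Qed.

(** Otherwise take the first coefficients [P_i] and [Q_j] that [d] does not divide: in the
    coefficient of index [i + j] every term but [P_i Q_j] is divisible by [d]. *)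
Lemma irred_dvd_coefM d P Q : irreducible_poly d -> (forall i, d %| (P * Q)`_i) ->
  (forall i, d %| P`_i) \/ (forall i, d %| Q`_i).
Proof.
move=> id dPQ; apply: NNPP => /not_or_and [/not_all_ex_not nP /not_all_ex_not nQ].
have [i ni mi] := min_nat nP; have [j nj mj] := min_nat nQ.
have := dPQ (i + j)%N; rewrite coefM.
have ilt : (i < (i + j).+1)%N by rewrite ltnS leq_addr.
rewrite (bigD1 (Ordinal ilt)) //= addKn => h.
have : d %| P`_i * Q`_j.
  move: h; rewrite dvdp_addl //; apply: (big_ind (fun q => d %| q)) => [|a b|k nk]; first exact: dvdp0.
    exact: dvdp_add.
  case: (ltngtP k i) nk => [lt _|gt _|e]; last by rewrite -val_eqE /= e eqxx.
    apply: dvdp_mulr; apply/negPn/negP => /negP H.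
    by have := mi _ H; rewrite leqNgt lt.
  apply: dvdp_mull; apply/negPn/negP => /negP H.
  have := mj _ H; rewrite leqNgt => /negP; apply.
  have kij : (k <= i + j)%N by rewrite -ltnS.
  by rewrite ltn_subLR // ltn_add2r.
by case/(irred_dvdM id)/orP.
Qed.

Lemma dvd_coefs d P : (forall i, d %| P`_i) -> exists Q, P = d%:P * Q.
Proof.
move=> h; exists (\poly_(i < size P) (P`_i %/ d)); apply/polyP => i.
rewrite coefCM coef_poly; case: ltnP => [_|le]; first by rewrite mulrC divpK.
by rewrite nth_default // mulr0.
Qed.

(** The irreducible factors of [a] are removed one at a time: each divides all coefficients of [P]
    or all those of [R], and primitivity excludes [P]. *)
Lemma gauss_dvd P Q R a : primitive P -> a != 0 -> a%:P * Q = P * R ->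
  exists R', Q = P * R'.
Proof.
move=> pP; have [n] := ubnP (size a); elim: n a R => // n IH a R; rewrite ltnS => sa a0 e.
have [s1|s1] := leqP (size a) 1.
  move: (size1_polyC s1) => ea; have c0 : a`_0 != 0 by move: a0; rewrite {1}ea polyC_eq0.
  exists ((a`_0)^-1%:P%:P * R); rewrite mulrCA -e mulrA -!polyCM {2}ea -polyCM mulVf //.
  by rewrite !polyC1 mul1r.
have [d id da] := irred_factor s1.
have d0 : d != 0 by apply: contraNneq a0 => d0; move: da; rewrite d0 dvd0p.
have hPR i : d %| (P * R)`_i by rewrite -e coefCM dvdp_mulr.
have [hP|hR] := irred_dvd_coefM id hPR.
  by move: id.1; rewrite (pP _ hP).
have [R1 eR] := dvd_coefs hR.
have ea : a = d * (a %/ d) by rewrite mulrC divpK.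
apply: (IH (a %/ d) R1).
- apply: leq_trans sa; rewrite size_divp // ltn_subrL size_poly_gt0 a0 andbT.
  by have := id.1; case: (size d) => [|[|]].
- by apply: contraNneq a0 => h; rewrite ea h mulr0.
have dn : d%:P != 0 :> {poly {poly K}} by rewrite polyC_eq0.
by apply: (mulfI dn); rewrite mulrA -polyCM -ea e eR mulrCA.
Qed.
End Gauss.

Section RationalFunctions.
Variable K : fieldType.
Local Notation F := {fraction {poly K}}.
Local Notation tof := (@FracField.tofrac {poly K}).
Implicit Types (f g h : F) (u v a b : {poly K}).

Definition cst : {rmorphism K -> F} := tof \o polyC.
Definition xF : F := tof 'X.

Lemma ev_tof u : (map_poly cst u).[xF] = tof u.
Proof.
rewrite horner_coef size_map_inj_poly ?rmorph0 //; last first.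
  by apply: fmorph_inj.
transitivity (tof (\poly_(i < size u) u`_i)); last by rewrite coefK.
rewrite poly_def rmorph_sum /=.
apply: eq_bigr => i _; rewrite coef_map /= -mul_polyC rmorphM rmorphXn //.
Qed.

Lemma cstE k : cst k = tof k%:P. Proof. by []. Qed.

Lemma tof_inj : injective tof.
Proof. by move=> a b /eqP; rewrite tofrac_eq => /eqP. Qed.

Lemma fracP_coprime f : exists a b, [/\ coprimep a b, b != 0 & f = tof a / tof b].
Proof.
have [a [b [b0 ->]]] := fracP f.
pose g := gcdp a b; have g0 : g != 0 by rewrite gcdp_eq0 negb_and b0 orbT.
have ea : a = (a %/ g) * g by rewrite divpK // dvdp_gcdl.
have eb : b = (b %/ g) * g by rewrite divpK // dvdp_gcdr.
have bg0 : b %/ g != 0 by apply: contraNneq b0 => h; rewrite eb h mul0r.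
exists (a %/ g), (b %/ g); split=> //.
  by apply: coprimep_div_gcd; rewrite b0 orbT.
by apply/frac_eq => //; rewrite {1}ea {2}eb -!mulrA [g * _]mulrC.
Qed.

(** After multiplication by [b^m], all terms but the top one are divisible by [b], and all but the
    bottom one by [a]. *)
Lemma ratroot (q : {poly {poly K}}) a b : coprimep a b -> b != 0 ->
  (map_poly tof q).[tof a / tof b] = 0 -> (b %| lead_coef q) && (a %| q`_0).
Proof.
move=> cab b0; have [-> _|q0] := eqVneq q 0; first by rewrite lead_coef0 coef0 !dvdp0.
have b0' : tof b != 0 by rewrite tofrac_eq0.
have [m em] : exists m, size q = m.+1.
  by exists (size q).-1; rewrite prednK // lt0n size_poly_eq0.
rewrite horner_coef size_map_inj_poly ?rmorph0 //; last exact: tof_inj.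
rewrite em => h.
have {}h : \sum_(i < m.+1) q`_i * (a ^+ i * b ^+ (m - i)) = 0.
  apply: tof_inj; rewrite rmorph0 -(mul0r (tof b ^+ m)) -h rmorph_sum mulr_suml.
  apply: eq_bigr => i _; rewrite coef_map !rmorphM !rmorphXn /= -!mulrA; congr (_ * _).
  have im : (i <= m)%N by rewrite -ltnS.
  exact: esym (expr_div_clear _ im b0').
apply/andP; split.
  move: h; rewrite big_ord_recr /= subnn expr0 mulr1 => /eqP.
  rewrite addr_eq0 => /eqP h; rewrite lead_coefE em /=.
  have : b %| q`_m * a ^+ m.
    rewrite -dvdpNr -h; apply: (big_ind (fun q => _ %| q)) => [|c d|i _]; [exact: dvdp0|exact: dvdp_add|].
    by rewrite !dvdp_mull // dvdp_exp // subn_gt0.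
  by rewrite Gauss_dvdpl // coprimep_expr // coprimep_sym.
move: h; rewrite big_ord_recl /= subn0 expr0 mul1r => /eqP.
rewrite addr_eq0 => /eqP h.
have : a %| q`_0 * b ^+ m.
  rewrite h dvdpNr; apply: (big_ind (fun q => _ %| q)) => [|c d|i _]; [exact: dvdp0|exact: dvdp_add|].
  by rewrite dvdp_mull // dvdp_mulr // dvdp_exp.
by rewrite Gauss_dvdpl // coprimep_expr.
Qed.

Lemma size1_const b : size b = 1%N -> exists2 c : K, c != 0 & b = c%:P.
Proof. by move/eqP/size_poly1P. Qed.

(** If [u(f) = 0], the rational root theorem makes the denominator of [f] constant. Then [f] is a
    polynomial [d], and [u \Po d = 0] forces [u] or [d] to be constant by degrees. *)
Lemma nonconst_transc f : (forall k, f <> cst k) -> transc cst f.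
Proof.
move=> nf u hu; apply/eqP/negPn/negP => u0.
have [a [b [cab b0 ef]]] := fracP_coprime f.
have := @ratroot (map_poly polyC u) a b cab b0; rewrite -map_poly_comp -ef.
move=> /(_ hu) /andP[bu _].
have : lead_coef (map_poly polyC u) = (lead_coef u)%:P by rewrite lead_coef_map.
move=> e; move: bu; rewrite e -[_%:P]mulr1 mul_polyC dvdpZr ?lead_coef_eq0 // dvdp1.
move=> /eqP /size1_const [c c0 eb].
have ef' : f = tof (c^-1 *: a).
  rewrite ef eb -mul_polyC rmorphM mulrC; congr (_ * _); rewrite -[tof c%:P]cstE.
  by rewrite -fmorphV.
move: hu; rewrite ef'; set d := _ *: a => hu.
have : u \Po d = 0.
  apply: tof_inj; rewrite rmorph0 -hu comp_polyE rmorph_sum /= horner_coef.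
  rewrite size_map_inj_poly ?rmorph0 //; last exact: fmorph_inj.
  apply: eq_bigr => i _; rewrite coef_map -mul_polyC rmorphM rmorphXn //.
move/(congr1 (fun p : {poly K} => (size p).-1)); rewrite size_poly0 size_comp_poly /=.
move/eqP; rewrite muln_eq0 => /orP[] h.
  have : size u = 1%N by move: h u0; rewrite -size_poly_eq0; case: (size u) => [|[|]].
  move=> /size1_const [k k0 eu]; move: hu; rewrite eu map_polyC hornerC => /eqP.
  by rewrite fmorph_eq0 (negbTE k0).
have : (size d <= 1)%N by move: h; case: (size d) => [|[|]].
by move/size1_polyC => ed; apply: (nf d`_0); rewrite ef' cstE -ed.
Qed.

Lemma coefs_cst (p : {poly F}) : (forall i, exists k, p`_i = cst k) ->
  exists r, p = map_poly cst r.
Proof.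
move=> h; have [a ha] := fin_all_exists (fun i : 'I_(size p) => h i).
exists (\poly_(i < size p) oapp a 0 (insub i)); apply/polyP => i.
rewrite coef_map coef_poly; case: ltnP => [lt|ge].
  by rewrite (insubT (fun i => i < size p)%N lt); apply: (ha (Ordinal lt)).
by rewrite nth_default // rmorph0.
Qed.

End RationalFunctions.

Lemma min_measure (T : Type) (m : T -> nat) (P : T -> Prop) : (exists x, P x) ->
  exists2 x, P x & forall y, P y -> (m x <= m y)%N.
Proof.
move=> [x0 Px0]; have [|n [x [Px <-]] mn] := @min_nat (fun n => exists x, P x /\ m x = n).
  by exists (m x0), x0.
by exists x => // y Py; apply: mn; exists y.
Qed.

Lemma scale_div (F : fieldType) (A B : {poly F}) (q d : F) : d != 0 ->
  q *: B = d *: A -> A = (q / d) *: B.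
Proof. by move=> d0 e; rewrite mulrC -scalerA e scalerA mulVf // scale1r. Qed.

Lemma div_neq0 (F : fieldType) (a b : F) : a != 0 -> b != 0 -> a / b != 0.
Proof. by move=> a0 b0; rewrite mulf_neq0 ?invr_eq0. Qed.

Lemma mul_div_cancel (F : fieldType) (a b : F) : b != 0 -> a = (b * a) / b.
Proof. by move=> b0; rewrite mulrC mulKf. Qed.

Lemma dvdp_scale (F : fieldType) (A B : {poly F}) (a b c : F) :
  a != 0 -> b != 0 -> c != 0 -> a *: A = b *: (c *: B) -> A %| B.
Proof.
move=> a0 b0 c0 e; rewrite -(dvdpZl _ _ a0) e scalerA dvdpZl //.
exact: mulf_neq0.
Qed.

Lemma cofactor_clear (F : fieldType) (L p w : {poly F}) (b c v : F) : L = w * p ->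
  (b * c)%:P * (v *: L) = (b *: p) * (v%:P * (c *: w)).
Proof. by move=> ->; rewrite -!mul_polyC polyCM; ring. Qed.

Section MinPoly.
Variables (F : fieldType) (E : F -> Prop) (x : F).
Hypothesis sE : subfield_closed E.
Hypothesis algx : exists p : {poly F}, [/\ p != 0, coefs_in E p & p.[x] = 0].

Lemma min_poly_over : exists p : {poly F},
  [/\ p \is monic, coefs_in E p, p.[x] = 0 &
      forall q, coefs_in E q -> q.[x] = 0 -> p %| q].
Proof.
have [p [p0 Ep px] mn] := min_measure (fun p : {poly F} => size p) algx.
have lc0 : lead_coef p != 0 by rewrite lead_coef_eq0.
exists ((lead_coef p)^-1 *: p); split.
- by rewrite monicE lead_coefZ mulVf.
- by move=> i; rewrite coefZ; apply: (subM sE) => //; apply: (subV sE); rewrite lead_coefE.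
- by rewrite hornerZ px mulr0.
move=> q Eq qx; rewrite dvdpZl ?invr_eq0 // /dvdp; apply/negPn/negP => r0.
have rx : (q %% p).[x] = 0.
  by move: qx; rewrite {1}(divp_eq q p) hornerD hornerM px mulr0 add0r.
have := mn _ (And3 r0 (coefs_in_modp sE p0 Eq Ep) rx).
by rewrite leqNgt ltn_modp p0.
Qed.
End MinPoly.

Section Biv.
Variable K : fieldType.
Local Notation F := {fraction {poly K}}.
Local Notation tof := (@FracField.tofrac {poly K}).
Local Notation cst := (@cst K).
Implicit Types (P Q R : {poly {poly K}}) (u v d : {poly K}).

(* [u(T) v(x) - v(T) u(x)], with [T] the outer and [x] the inner variable. *)
Definition biv u v : {poly {poly K}} := map_poly polyC u * v%:P - map_poly polyC v * u%:P.

Lemma swap_biv u v : swapXY (biv u v) = u%:P * map_poly polyC v - v%:P * map_poly polyC u * 1.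
Proof.
by rewrite /biv rmorphB !rmorphM /= !swapXY_map_polyC !swapXY_polyC mulr1.
Qed.

Lemma sizeY_biv u v : (sizeY (biv u v) <= maxn (size u) (size v))%N.
Proof.
rewrite sizeYE swap_biv mulr1 (leq_trans (size_polyD _ _)) // size_polyN.
rewrite maxnC geq_max !mul_polyC.
rewrite !(leq_trans (size_scale_leq _ _)) // size_map_polyC leq_max leqnn ?orbT //.
Qed.

(** Dividing out a nonconstant content would lower the degree in the inner variable, which [sizeY]
    measures. *)
Lemma primitive_min (P : {poly {poly K}}) : P != 0 ->
  (forall d Q, P = d%:P * Q -> (sizeY P <= sizeY Q)%N) -> primitive P.
Proof.
move=> P0 mP d /dvd_coefs [Q e].
have d0 : d != 0 by apply: contraNneq P0 => h; rewrite e h mul0r.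
have Q0 : Q != 0 by apply: contraNneq P0 => h; rewrite e h mulr0.
have := mP d Q e; rewrite !sizeYE e rmorphM /= swapXY_polyC size_mul ?map_polyC_eq0 ?swapXY_eq0 //.
rewrite size_map_polyC -ltnS prednK; last first.
  by rewrite ltn_addr // size_poly_gt0.
rewrite addnC -addn1 leq_add2l; move: d0; rewrite -size_poly_gt0.
by case: (size d) => [|[|]].
Qed.

(** Comparing degrees in [x] leaves [R] a polynomial [r] in [T] alone, which divides every
    combination [v_k u - u_k v]. The nonzero minor recovers [u] and [v] from two of these, so [r]
    divides both. *)
Lemma biv_cofactor u v P R : coprimep u v -> (exists i j, u`_i * v`_j != u`_j * v`_i) ->
  (maxn (size u) (size v) <= sizeY P)%N -> biv u v = P * R -> exists2 r : K, r != 0 & R = r%:P%:P.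
Proof.
move=> cuv [i [j nij]] le e.
have B0 : swapXY (biv u v) != 0.
  apply/eqP => /(congr1 (fun Q : {poly {poly K}} => Q`_i`_j)).
  rewrite swap_biv mulr1 coefB !coefCM !coef_map /= !coef0 coefB !coefMC => /eqP.
  by rewrite subr_eq0 [v`_j * _]mulrC eq_sym (negbTE nij).
move: (B0); rewrite swapXY_eq0 e mulf_eq0 negb_or => /andP[P0 R0].
have sR : (size (swapXY R) <= 1)%N.
  have := sizeY_biv u v; rewrite e !sizeYE rmorphM /= size_mul ?swapXY_eq0 //.
  rewrite -!sizeYE => h; have := leq_trans h le.
  have : (0 < sizeY P)%N by rewrite sizeYE size_poly_gt0 swapXY_eq0.
  case: (sizeY P) => // a _; rewrite addSn /= -addn1 leq_add2l //.
have [r er] : exists r, swapXY R = r%:P by exists (swapXY R)`_0; apply: size1_polyC.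
have dvd k : r %| (v`_k)%:P * u - (u`_k)%:P * v.
  have := congr1 (fun Q : {poly {poly K}} => (swapXY Q)`_k) e.
  rewrite swap_biv rmorphM /= er mulr1 coefB !coefCM !coef_map /= coefMC => h.
  by rewrite mulrC [(u`_k)%:P * v]mulrC h dvdp_mull.
have w0 : u`_j * v`_i - u`_i * v`_j != 0 by rewrite subr_eq0 eq_sym.
have du : r %| u.
  rewrite -(dvdpZr _ _ w0) -mul_polyC.
  have -> : (u`_j * v`_i - u`_i * v`_j)%:P * u =
    (u`_j)%:P * ((v`_i)%:P * u - (u`_i)%:P * v) - (u`_i)%:P * ((v`_j)%:P * u - (u`_j)%:P * v).
    by rewrite polyCB !polyCM; ring.
  by apply: dvdp_sub; apply: dvdp_mull.
have dv : r %| v.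
  rewrite -(dvdpZr _ _ w0) -mul_polyC.
  have -> : (u`_j * v`_i - u`_i * v`_j)%:P * v =
    (v`_j)%:P * ((v`_i)%:P * u - (u`_i)%:P * v) - (v`_i)%:P * ((v`_j)%:P * u - (u`_j)%:P * v).
    by rewrite polyCB !polyCM; ring.
  by apply: dvdp_sub; apply: dvdp_mull.
have : r %| gcdp u v by rewrite dvdp_gcd du.
have /size_poly1P [c c0 ->] : size (gcdp u v) == 1%N by [].
rewrite -[c%:P]mulr1 mul_polyC dvdpZr // dvdp1 => /size_poly1P [r0 r00 er0].
by exists r0 => //; rewrite -[R]swapXYK er swapXY_polyC er0 map_polyC.
Qed.
End Biv.

Section Luroth.
Variable K : fieldType.
Local Notation F := {fraction {poly K}}.
Local Notation tof := (@FracField.tofrac {poly K}).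
Local Notation cst := (@cst K).
Local Notation x := (xF K).
Implicit Types (P Q R : {poly {poly K}}) (u v d : {poly K}).

(* [u(T) - f v(T)] for [f = u / v], which has the root [T = x]. *)
Definition linF u v : {poly F} := map_poly cst u - (tof u / tof v) *: map_poly cst v.

Lemma linF_root u v : v != 0 -> (linF u v).[x] = 0.
Proof.
move=> v0; rewrite hornerD hornerN hornerZ !ev_tof divfK ?subrr //.
by rewrite tofrac_eq0.
Qed.

Lemma linF_biv u v : v != 0 -> map_poly tof (biv u v) = tof v *: linF u v.
Proof.
move=> v0; rewrite /biv rmorphB !rmorphM /= !map_polyC -!map_poly_comp scalerBr.
rewrite mulrC mul_polyC; congr (_ - _); rewrite scalerA mulrC [tof v * _]mulrC divfK ?tofrac_eq0 //.
by rewrite mul_polyC.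
Qed.

Lemma linF_coefs (S : F -> Prop) u v : subfield_closed S -> (forall k, S (cst k)) ->
  S (tof u / tof v) -> coefs_in S (linF u v).
Proof.
move=> sS Sc Sf i; rewrite coefB coefZ !coef_map.
by apply: (subB sS); [exact: Sc|apply: (subM sS) => //; exact: Sc].
Qed.

Lemma nonconst_minor u v : v != 0 -> (forall k, tof u / tof v <> cst k) ->
  exists i j, u`_i * v`_j != u`_j * v`_i.
Proof.
move=> v0 nc; apply: NNPP => H; apply: (nc (u`_(size v).-1 / lead_coef v)).
have lv : lead_coef v != 0 by rewrite lead_coef_eq0.
have e : u = (u`_(size v).-1 / lead_coef v)%:P * v.
  apply/polyP => i; rewrite coefCM; apply: (mulIf lv).
  rewrite mulrAC divfK //; apply/eqP/negPn/negP => h; apply: H.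
  by exists i, (size v).-1.
by rewrite {1}e tofracM mulfK ?tofrac_eq0.
Qed.

Lemma linF_neq0 u v : v != 0 -> (forall k, tof u / tof v <> cst k) -> linF u v != 0.
Proof.
move=> v0 nf; apply/eqP => l0.
have [i [j nij]] := nonconst_minor v0 nf.
have ml k : cst u`_k = (tof u / tof v) * cst v`_k.
  have := congr1 (fun q : {poly F} => q`_k) l0.
  by rewrite coefB coefZ !coef_map coef0 => /eqP; rewrite subr_eq0 => /eqP.
move/eqP: nij; apply; apply: (fmorph_inj cst).
by rewrite !rmorphM (ml i) (ml j) mulrAC.
Qed.

Section Field.
Variable E : F -> Prop.
Hypothesis sE : subfield_closed E.
Hypothesis Ec : forall k, E (cst k).

(* If [P] is the primitive form of the minimal polynomial of [x] over [E] and [u / v] is a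
   nonconstant ratio of two of its coefficients, then [P] divides [biv u v] by Gauss, the degrees
   in [x] agree, and a cofactor free of [x] would divide both [u] and [v]. *)
Lemma luroth_gen : (exists2 f, E f & forall k, f <> cst k) ->
  exists u v, [/\ v != 0, E (tof u / tof v), (forall k, tof u / tof v <> cst k) &
    forall q, coefs_in E q -> q.[x] = 0 -> linF u v %| q].
Proof.
move=> [f0 Ef0 nf0].
have [u1 [v1 [_ v10 ef0]]] := fracP_coprime f0.
have [p [mp Ep px minp]] : exists p : {poly F},
  [/\ p \is monic, coefs_in E p, p.[x] = 0 &
      forall q, coefs_in E q -> q.[x] = 0 -> p %| q].
  apply: min_poly_over => //; exists (linF u1 v1); split; last exact: linF_root.
    by apply: linF_neq0 => //; rewrite -ef0.
  by apply: linF_coefs => //; rewrite -ef0.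
have p0 : p != 0 by rewrite monic_neq0.
pose good P := P != 0 /\ exists q : F, q != 0 /\ map_poly tof P = q *: p.
have [P [P0 [q [q0 eP]]] mP] : exists2 P, good P & forall Q, good Q -> (sizeY P <= sizeY Q)%N.
  apply: min_measure; have [b [P [b0 e]]] := clear_denoms p.
  have b0' : tof b != 0 by rewrite tofrac_eq0.
  exists P; split; last by exists (tof b).
  apply/eqP => P0; move: e; rewrite P0 rmorph0 => /esym/eqP.
  by rewrite scaler_eq0 (negbTE b0') (negbTE p0).
have primP : primitive P.
  apply: primitive_min => // d Q e; apply: mP.
  have d0 : d != 0 by apply: contraNneq P0 => h; rewrite e h mul0r.
  have d0' : tof d != 0 by rewrite tofrac_eq0.
  split; first by apply: contraNneq P0 => h; rewrite e h mulr0.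
  have H : q *: p = tof d *: map_poly tof Q.
    by rewrite -eP e rmorphM /= map_polyC /= mul_polyC.
  by exists (q / tof d); split; [exact: (div_neq0 q0 d0')|exact: (scale_div d0' H)].
have eq : q = tof (lead_coef P).
  rewrite -[LHS]mulr1 -(monicP mp) -lead_coefZ -eP lead_coef_map_inj ?rmorph0 //.
  exact: tof_inj.
have [i nfi] : exists i, forall k, p`_i <> cst k.
  apply: NNPP => H; have [i|r er] := @coefs_cst K p.
    by apply: NNPP => h; apply: H; exists i => k hk; apply: h; exists k.
  move: px; rewrite er ev_tof => /eqP; rewrite tofrac_eq0 => /eqP r0.
  by move: p0; rewrite er r0 rmorph0 eqxx.
pose a := P`_i; pose b := lead_coef P.
have b0 : b != 0 by rewrite lead_coef_eq0.
have eab : p`_i = tof a / tof b.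
  have -> : tof a = q * p`_i by rewrite -coefZ -eP coef_map.
  have tb0 : tof b != 0 by rewrite tofrac_eq0.
  by rewrite eq; exact: mul_div_cancel tb0.
pose g := gcdp a b; have g0 : g != 0 by rewrite gcdp_eq0 negb_and b0 orbT.
pose u := a %/ g; pose v := b %/ g.
have ea : a = u * g by rewrite divpK // dvdp_gcdl.
have eb : b = v * g by rewrite divpK // dvdp_gcdr.
have v0 : v != 0 by apply: contraNneq b0 => h; rewrite eb h mul0r.
have cuv : coprimep u v by apply: coprimep_div_gcd; rewrite b0 orbT.
have euv : p`_i = tof u / tof v.
  by rewrite eab; apply/frac_eq => //; rewrite ea eb -!mulrA [g * _]mulrC.
have su : (size u <= sizeY P)%N.
  by rewrite (leq_trans (leq_divp _ _)) // max_size_coefXY.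
have sv : (size v <= sizeY P)%N.
  by rewrite (leq_trans (leq_divp _ _)) // max_size_lead_coefXY.
exists u, v; split=> //; [by rewrite -euv|by rewrite -euv|].
have Elin : coefs_in E (linF u v) by apply: linF_coefs => //; rewrite -euv.
have /dvdpP [w ew] := minp _ Elin (linF_root u v0).
have [R eR] : exists R, biv u v = P * R.
  have [c [R [c0 e]]] := clear_denoms w.
  apply: (@gauss_dvd K P _ (v%:P * R) (b * c)) => //.
    by rewrite mulf_neq0.
  apply: (map_inj_poly (@tof_inj K)); first by rewrite rmorph0.
  rewrite [LHS]rmorphM [RHS]rmorphM /= [map_poly _ (v%:P * R)]rmorphM /= !map_polyC /=.
  rewrite linF_biv // eP e eq tofracM; exact: cofactor_clear.
have [r r0 er] : exists2 r : K, r != 0 & R = r%:P%:P.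
  apply: (biv_cofactor cuv _ _ eR); last by rewrite geq_max su sv.
  by apply: nonconst_minor => //; rewrite -euv.
move=> q1 Eq1 q1x; apply: dvdp_trans (minp _ Eq1 q1x).
have tv0 : tof v != 0 by rewrite tofrac_eq0.
have r0' : tof r%:P != 0 by rewrite tofrac_eq0 polyC_eq0.
have H : tof v *: linF u v = tof r%:P *: (q *: p).
  by rewrite -linF_biv // eR er rmorphM /= map_polyC /= mulrC mul_polyC eP.
exact: (dvdp_scale tv0 r0' q0 H).
Qed.

(** Write [h = c / d]. Modulo [linF u v] the polynomials [c(T)] and [h d(T)] agree, since their
    difference has coefficients in [E] and the root [x]. The remainders of [c] and [d] have
    coefficients in [K(f)], so [h] is a quotient of two such coefficients. *)
Lemma luroth : (exists2 f, E f & forall k, f <> cst k) ->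
  exists f, [/\ E f, forall k, f <> cst k & forall h, E h -> ratgen cst f h].
Proof.
move=> /luroth_gen [u [v [v0 Ef nf dv]]].
exists (tof u / tof v); split=> // h Eh.
set f := tof u / tof v in Ef nf *.
have [c [d [_ d0 eh]]] := fracP_coprime h.
have hd : linF u v %| linF c d.
  by apply: dv; [apply: linF_coefs => //; rewrite -eh|exact: linF_root].
have l0 : linF u v != 0.
  exact: linF_neq0.
pose rc := map_poly cst c %% linF u v; pose rd := map_poly cst d %% linF u v.
have e : rc = h *: rd.
  apply/eqP; rewrite -subr_eq0 -modpZl -modpN -modpD -/(_ %| _) eh; exact: hd.
have Sl : coefs_in (ratgen cst f) (linF u v).
  by apply: linF_coefs; [exact: ratgen_sub|exact: ratgenC|exact: ratgen_self].
have Sc (w : {poly K}) : coefs_in (ratgen cst f) (map_poly cst w %% linF u v).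
  apply: coefs_in_modp => //; first exact: ratgen_sub.
  by move=> i; rewrite coef_map; apply: ratgenC.
(* If [linF u v] divided [d(T)], evaluation at [x] would give [d = 0]. *)
have rd0 : rd != 0.
  apply/negP => /= /dvdpP [w ew]; have := ev_tof d.
  rewrite ew hornerM linF_root // mulr0 => /esym/eqP.
  by rewrite tofrac_eq0 (negbTE d0).
have -> : h = rc`_(size rd).-1 / lead_coef rd.
  by rewrite e coefZ -lead_coefE mulfK // lead_coef_eq0.
by apply: subdiv; [exact: ratgen_sub|exact: Sc|rewrite lead_coefE; exact: Sc].
Qed.
End Field.
End Luroth.

(** * Kronecker substitution *)

Lemma digits_inj N d (a b : nat -> nat) : (forall i, a i < N)%N -> (forall i, b i < N)%N ->
  (\sum_(i < d) a i * N ^ i = \sum_(i < d) b i * N ^ i)%N -> forall i, (i < d)%N -> a i = b i.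
Proof.
elim: d a b => // d IH a b ha hb; rewrite !big_ord_recl /= !expn0 !muln1.
have rec (f : nat -> nat) : (\sum_(i < d) f (bump 0 i) * N ^ bump 0 i =
    (\sum_(i < d) f i.+1 * N ^ i) * N)%N.
  by rewrite big_distrl; apply: eq_bigr => i _ /=; rewrite /bump add1n expnSr mulnA.
rewrite !rec => e.
have N0 : (0 < N)%N by apply: leq_ltn_trans (ha 0%N).
have e0 : a 0%N = b 0%N.
  by have := congr1 (modn^~ N) e; rewrite /= ![(_ + _ * N)%N]addnC !modnMDl !modn_small.
move: e; rewrite e0 => /addnI /eqP; rewrite eqn_pmul2r // => /eqP e [|i] // lt.
exact: (IH (fun i => a i.+1) (fun i => b i.+1)).
Qed.

Lemma rmorph_mmap (n : nat) (R : fieldType) (S : comNzRingType)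
    (g : {rmorphism {mpoly R[n]} -> S}) (p : {mpoly R[n]}) :
  g p = mmap (fun c => g c%:MP) (fun i => g 'X_i) p.
Proof.
rewrite [in LHS](mpolyE p) rmorph_sum /mmap; apply: eq_bigr => m _.
have -> : g (p@_m *: 'X_[m]) = g (p@_m)%:MP * g 'X_[m].
  by rewrite -(rmorphM g) mul_mpolyC.
congr (_ * _).
by rewrite (mpolyXE _ 1%g) rmorph_prod; apply: eq_bigr => i _; rewrite perm1 rmorphXn.
Qed.

Lemma eq_mmap (n : nat) (R : fieldType) (S : comNzRingType) (f f' : R -> S) (h h' : 'I_n -> S) p :
  f =1 f' -> h =1 h' -> mmap f h p = mmap f' h' p.
Proof.
move=> ef eh; apply: eq_bigr => m _; rewrite ef; congr (_ * _).
by apply: eq_bigr => i _; rewrite eh.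
Qed.

Section Kronecker.
Variables (K : fieldType) (d : nat).
Implicit Types q a b : {mpoly K[d]}.

(* Kronecker substitution: [x_i |-> x^(N^i)]. *)
Definition kron (N : nat) : {rmorphism {mpoly K[d]} -> {poly K}} :=
  mmap polyC (fun i : 'I_d => 'X^(N ^ i)).

Definition kkey (N : nat) (m : 'X_{1..d}) := (\sum_(i < d) m i * N ^ i)%N.

Lemma kronC N c : kron N c%:MP = c%:P. Proof. exact: mmapC. Qed.

Lemma kronE N q : kron N q = \sum_(m <- msupp q) q@_m *: 'X^(kkey N m).
Proof.
apply: eq_bigr => m _; rewrite mul_polyC; congr (_ *: _).
rewrite /mmap1 /kkey.
elim/big_rec2: _ => [|i x y _ ->]; first by rewrite expr0.
by rewrite exprD mulnC exprM.
Qed.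

(** All exponents are below [N], so [kkey] reads them as base-[N] digits: distinct monomials become
    distinct powers and nothing cancels. *)
Lemma kron_inj N q : (msize q <= N)%N -> kron N q = 0 -> q = 0.
Proof.
move=> sq e; apply/eqP; rewrite -msupp_eq0; apply/eqP.
case es : (msupp q) => [//|m0 s].
have m0q : m0 \in msupp q by rewrite es mem_head.
have := congr1 (fun p : {poly K} => p`_(kkey N m0)) e.
rewrite kronE coef_sum coef0 (bigD1_seq m0) ?msupp_uniq //=.
rewrite coefZ coefXn eqxx mulr1 big_seq_cond big1 ?addr0 => [/eqP h|m /andP[mq nm]].
  by move: m0q; rewrite mcoeff_msupp h.
rewrite coefZ coefXn; case: eqP => [ek|_]; last by rewrite mulr0.
case/eqP: nm; apply/mnmP => i.
(* Exponent vectors are padded by 0 beyond [d], to become the digit sequences on [nat] that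
   [digits_inj] expects. *)
have bd m' : m' \in msupp q -> forall j : nat, (oapp (m' : 'I_d -> nat) 0%N (insub j) < N)%N.
  move=> m'q j; have lt := leq_trans (msize_mdeg_lt m'q) sq.
  case: insubP => [k _ _|_] /=; last exact: leq_ltn_trans lt.
  apply: leq_ltn_trans lt; rewrite mdegE (bigD1 k) //= leq_addr //.
have := @digits_inj N d _ _ (bd _ mq) (bd _ m0q) _ i (ltn_ord i).
rewrite !valK /=; apply; move: ek; rewrite /kkey => ek.
transitivity (\sum_(i0 < d) m i0 * N ^ i0)%N; first by apply: eq_bigr => j _; rewrite valK.
by rewrite -ek; apply: eq_bigr => j _; rewrite valK.
Qed.

Lemma kron_nonconst N a b k : (msize a <= N)%N -> (msize b <= N)%N ->
  kron N a = k%:P * kron N b -> a = k%:MP * b.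
Proof.
move=> sa sb e; apply/eqP; rewrite -subr_eq0; apply/eqP; apply: (@kron_inj N).
  rewrite (leq_trans (msizeD_le _ _)) // geq_max sa msizeN mul_mpolyC.
  exact: leq_trans (msizeZ_le _ _) sb.
by rewrite rmorphB rmorphM /= kronC e subrr.
Qed.

End Kronecker.

(** * Polynomial relations in one and two variables *)

Section OneTwoVariables.
Variables (K F : fieldType) (c : {rmorphism K -> F}).

(** With one variable the Kronecker substitution is [x_0 |-> x^(N^0) = x], so [kron] is the change
    of type, and its injectivity gives [u != 0]. *)
Lemma mpoly1_poly (Q : {mpoly K[1]}) (e : 'I_1 -> F) : Q != 0 ->
  exists2 u : {poly K}, u != 0 & mmap c e Q = (map_poly c u).[e ord0].
Proof.
move=> Q0; exists (kron K 1 (msize Q) Q).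
  by apply: contraNneq Q0 => /kron_inj ->.
pose g : {rmorphism {mpoly K[1]} -> F} := horner_eval (e ord0) \o (map_poly c \o kron K 1 (msize Q)).
rewrite -[RHS]/(g Q) [RHS]rmorph_mmap; apply: eq_mmap => [k|i].
  by rewrite /g /= kronC map_polyC /horner_eval hornerC.
rewrite /g /= /kron /= mmapX mmap1U ord1 expn0 expr1.
by rewrite map_polyX /horner_eval hornerX.
Qed.

Definition ev2 (f e : F) : {rmorphism {poly {poly K}} -> F} :=
  horner_eval e \o map_poly (horner_eval f \o map_poly c).

Lemma ev2_0 f (B : {poly {poly K}}) : ev2 f 0 B = (map_poly c B`_0).[f].
Proof. by rewrite /ev2 /= {1}/horner_eval horner_coef0 coef_map. Qed.

Lemma mpoly2_poly (Q : {mpoly K[2]}) : Q != 0 ->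
  exists2 B : {poly {poly K}}, B != 0 &
    forall e : 'I_2 -> F, mmap c e Q = ev2 (e ord0) (e ord_max) B.
Proof.
move=> Q0; pose h (i : 'I_2) : {poly {poly K}} := if i == ord0 then 'X%:P else 'X.
pose B : {rmorphism {mpoly K[2]} -> {poly {poly K}}} := mmap (polyC \o polyC) h.
have BC k : B k%:MP = k%:P%:P by apply: mmapC.
have BX i : B 'X_i = h i by rewrite /B /= mmapX mmap1U.
have h0 : h ord0 = 'X%:P by [].
have h1 : h ord_max = 'X by [].
exists (B Q).
  apply: contraNneq Q0 => B0; apply/eqP; apply: (@kron_inj K 2 (msize Q)) => //.
  (* Setting the outer variable to [X^N], with [N = msize Q], turns [B Q] into the Kronecker
     substitution of [Q], which vanishes only for [Q = 0]. *)
  pose g : {rmorphism {mpoly K[2]} -> {poly K}} := horner_eval ('X^(msize Q)) \o B.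
  transitivity (g Q); last by rewrite /g /= B0 rmorph0.
  rewrite [RHS]rmorph_mmap; apply: eq_mmap => [k|i].
    by rewrite /g /= BC /horner_eval hornerC.
  rewrite /g /= BX /horner_eval; case: (unliftP ord0 i) => [j|] ->.
    by rewrite ord1 /h /= hornerX expn1.
  by rewrite h0 hornerC expn0 expr1.
move=> e; pose g : {rmorphism {mpoly K[2]} -> F} := ev2 (e ord0) (e ord_max) \o B.
rewrite -[RHS]/(g Q) [RHS]rmorph_mmap; apply: eq_mmap => [k|i].
  by rewrite /g /= BC map_polyC /= map_polyC /horner_eval !hornerC.
rewrite /g /= BX; case: (unliftP ord0 i) => [j|] ->.
  have -> : lift ord0 j = ord_max by apply: val_inj; rewrite /= ord1.
  by rewrite h1 map_polyX /horner_eval hornerX.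
by rewrite h0 map_polyC /= map_polyX /horner_eval hornerC hornerX.
Qed.
End OneTwoVariables.

Section Specialization.
Variables (K : fieldType) (R : idomainType) (F : fieldType).
Variables (c0 : {rmorphism K -> R}) (s : {rmorphism R -> F}).
Local Notation c := (@FracField.tofrac R \o c0 : {rmorphism K -> {fraction R}}).
Local Notation c' := (s \o c0 : {rmorphism K -> F}).

Lemma spec_poly (u : {poly K}) f f' : spec s f f' ->
  spec s (map_poly c u).[f] (map_poly c' u).[f'].
Proof.
move=> ff; elim/poly_ind: u => [|u k IH].
  by rewrite !rmorph0 !horner0 -(rmorph0 s) -tofrac0; apply: specT.
rewrite !rmorphD !rmorphM /= !map_polyX !map_polyC !hornerD !hornerM !hornerX !hornerC.
by apply: specD; [apply: specM|apply: specT].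
Qed.

Lemma spec_poly2 (B : {poly {poly K}}) f f' e e' : spec s f f' -> spec s e e' ->
  spec s (ev2 c f e B) (ev2 c' f' e' B).
Proof.
move=> ff ee; elim/poly_ind: B => [|u k IH].
  by rewrite !rmorph0 -(rmorph0 s) -tofrac0; apply: specT.
rewrite !rmorphD !rmorphM; apply: specD.
  apply: specM => //; rewrite /ev2 /= !map_polyX /horner_eval !hornerX //.
by rewrite /ev2 /= !map_polyC /= /horner_eval !hornerC; apply: spec_poly.
Qed.

(* A polynomial relation between [f] and [e], once divided by the largest power of [e],
   specializes to a nonzero polynomial vanishing at [f']. *)
Lemma spec_kernel0 (B : {poly {poly K}}) f f' e : B != 0 -> spec s f f' ->
  transc c' f' -> spec s e 0 -> ev2 c f e B = 0 -> e = 0.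
Proof.
have [n] := ubnP (size B); elim: n B => // n IH B; rewrite ltnS => sB B0 ff tf ee eB.
have [b0|b0] := eqVneq B`_0 0; last first.
  have := spec_poly2 B ff ee; rewrite eB => h.
  have z : spec s 0 0 by rewrite -(rmorph0 s) -tofrac0; apply: specT.
  have := spec_fun h z; rewrite ev2_0 => /tf /eqP.
  by rewrite (negbTE b0).
have [B' eB'] : exists B', B = B' * 'X.
  elim/poly_ind: B b0 {sB B0 eB} => [|p k _]; first by exists 0; rewrite mul0r.
  by rewrite coefD coefMX coefC /= add0r => ->; exists p; rewrite polyC0 addr0.
have B'0 : B' != 0 by apply: contraNneq B0 => h; rewrite eB' h mul0r.
move: eB; rewrite eB' rmorphM {2}/ev2 /= map_polyX /horner_eval hornerX => /eqP.
rewrite mulf_eq0 => /orP[/eqP h|/eqP //].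
by apply: (IH B') => //; rewrite -ltnS -size_mulX -?eB'.
Qed.
End Specialization.

Section FunctionField.
Variables (K : fieldType) (d : nat).
Local Notation tofr := (@FracField.tofrac {mpoly K[d]}).
Definition cKV : {rmorphism K -> KV K d} := tofr \o @mpolyC d K.
Definition krs (N : nat) : {rmorphism {mpoly K[d]} -> {fraction {poly K}}} :=
  @FracField.tofrac {poly K} \o kron K d N.

Lemma krsC N : krs N \o @mpolyC d K =1 cst K.
Proof. by move=> k; rewrite /= kronC. Qed.

Lemma krs_neq0 N b : (msize b <= N)%N -> b != 0 -> krs N b != 0.
Proof.
by move=> sb; apply: contraNneq => /eqP; rewrite /= tofrac_eq0 => /eqP /(kron_inj sb) ->.
Qed.

Lemma krs_nonconst N a b : (msize a <= N)%N -> (msize b <= N)%N -> b != 0 ->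
  (forall k, tofr a / tofr b <> cKV k) -> forall k, krs N a / krs N b <> cst K k.
Proof.
move=> sa sb b0 nc k e; apply: (nc k).
have kb0 := krs_neq0 sb b0.
have : krs N a = krs N (k%:MP * b).
  by rewrite rmorphM (krsC N k : krs N k%:MP = _) -e divfK.
move=> /eqP; rewrite /= tofrac_eq rmorphM /= kronC => /eqP /kron_nonconst -> //.
by rewrite tofracM mulfK // tofrac_eq0.
Qed.

Lemma eq_ev (F : fieldType) (c c' : {rmorphism K -> F}) u f : c =1 c' ->
  (map_poly c u).[f] = (map_poly c' u).[f].
Proof. by move=> e; rewrite (eq_map_poly e). Qed.

(** With [N] large enough for the numerator and denominator of this one [x], its image among the
    rational functions of one variable is defined and still nonconstant; a relation for [x] would
    specialize to one for that image. *)
Lemma KV_transc (x : KV K d) : (forall k, x <> cKV k) -> transc cKV x.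
Proof.
have [a [b [b0 ->]]] := fracP x => nc u.
pose N := maxn (msize a) (msize b).
have sa : (msize a <= N)%N by rewrite leq_maxl.
have sb : (msize b <= N)%N by rewrite leq_maxr.
have sp : spec (krs N) (tofr a / tofr b) (krs N a / krs N b).
  by exists a, b; rewrite krs_neq0.
move=> hu; have := spec_poly (@mpolyC d K) u sp; rewrite -/cKV hu => h.
have z : spec (krs N) 0 0 by rewrite -(rmorph0 (krs N)) -tofrac0; apply: specT.
have := spec_fun h z; rewrite (eq_ev _ _ (@krsC N)).
by apply: nonconst_transc; apply: krs_nonconst.
Qed.
End FunctionField.

(** * The action on the function field *)

Lemma artin_step1 (F : fieldType) (a b c e : F) :
  a * (b - c) * e = a * (b * e) - c * (a * e).
Proof. by ring. Qed.

Lemma artin_step2 (F : fieldType) (a b e s t : F) :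
  a * e + s = 0 -> a * (b * e) + t = 0 -> t - b * s = 0.
Proof.
move=> h1 h2; have -> : s = - (a * e) by apply/eqP; rewrite -addr_eq0 addrC h1.
have -> : t = - (a * (b * e)) by apply/eqP; rewrite -addr_eq0 addrC h2.
by ring.
Qed.

Lemma mul_sub_eq0 (F : fieldType) (a b c : F) : a * (b - c) = 0 -> b <> c -> a = 0.
Proof. by move/eqP; rewrite mulf_eq0 subr_eq0 => /orP[/eqP //|/eqP]. Qed.

Section Action.
Variables (K : fieldType) (gT : finGroupType) (G : {group gT}) (d : nat).
Variable rG : mx_representation K G d.
Local Notation ga := (Defs.gact rG).
Local Notation cK := (@cKV K d).
Local Notation tofr := (@FracField.tofrac {mpoly K[d]}).
Implicit Types (g h : gT) (q : {mpoly K[d]}) (x y : KV K d).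

Definition gsubst_rm g : {rmorphism {mpoly K[d]} -> {mpoly K[d]}} :=
  comp_mpoly [tuple \sum_(j < d) (rG (g^-1)%g j i) *: 'X_j | i < d].

Lemma gsubstX g i : gsubst rG g 'X_i = \sum_(j < d) rG (g^-1)%g j i *: 'X_j.
Proof. by rewrite /gsubst comp_mpolyXU -tnth_nth tnth_mktuple. Qed.

Lemma gsubstC g k : gsubst rG g k%:MP = k%:MP.
Proof. exact: comp_mpolyC. Qed.

Lemma rmorph_mpoly_eq (f f' : {rmorphism {mpoly K[d]} -> {mpoly K[d]}}) :
  (forall k, f k%:MP = f' k%:MP) -> (forall i, f 'X_i = f' 'X_i) -> f =1 f'.
Proof. by move=> eC eX q; rewrite rmorph_mmap [RHS]rmorph_mmap; apply: eq_mmap. Qed.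

Lemma gsubst1 q : gsubst rG 1%g q = q.
Proof.
apply: (@rmorph_mpoly_eq (gsubst_rm 1%g) idfun) => [k|i]; first exact: gsubstC.
rewrite -[LHS]/(gsubst rG 1%g 'X_i) gsubstX invg1 repr_mx1 (bigD1 i) //= mxE eqxx scale1r.
by rewrite big1 ?addr0 // => j ji; rewrite mxE (negbTE ji) scale0r.
Qed.

(* Row vectors make [gsubst] (hence [gact]) a right action. *)
Lemma gsubstM g h q : g \in G -> h \in G ->
  gsubst rG g (gsubst rG h q) = gsubst rG (h * g)%g q.
Proof.
move=> Gg Gh.
apply: (@rmorph_mpoly_eq (gsubst_rm g \o gsubst_rm h) (gsubst_rm (h * g)%g)) => [k|i].
  by rewrite -[LHS]/(gsubst rG g (gsubst rG h _)) -[RHS]/(gsubst rG _ _) !gsubstC.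
rewrite -[LHS]/(gsubst_rm g (gsubst rG h 'X_i)) -[RHS]/(gsubst rG _ 'X_i) !gsubstX.
rewrite rmorph_sum /=.
under eq_bigr => j _ do rewrite comp_mpolyZ -[comp_mpoly _ _]/(gsubst rG g 'X_j) gsubstX scaler_sumr.
rewrite exchange_big /=; apply: eq_bigr => k _.
rewrite invMg repr_mxM ?groupV // mxE scaler_suml; apply: eq_bigr => j _.
by rewrite scalerA mulrC.
Qed.

Definition gs g : {rmorphism {mpoly K[d]} -> KV K d} := tofr \o gsubst_rm g.

Lemma gs_inj g : g \in G -> forall q, gs g q = 0 -> q = 0.
Proof.
move=> Gg q /eqP; rewrite /= tofrac_eq0 => /eqP e.
have := gsubstM q (groupVr Gg) Gg; rewrite mulgV gsubst1 => <-.
have -> : gsubst rG g q = 0 by exact: e.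
exact: (rmorph0 (gsubst_rm g^-1)).
Qed.

Lemma gactT g q : g \in G -> ga g (tofr q) = tofr (gsubst rG g q).
Proof. by move=> Gg; apply: (frac_extensionT (gs_inj Gg)). Qed.

(** The action is multiplicative and additive only for [g] in [G], so the structure cannot be
    attached to [gact] itself; calculations pass to an equal morphism and back by rewriting. *)
Lemma gact_rm g : g \in G -> exists s : {rmorphism KV K d -> KV K d}, s =1 ga g.
Proof.
move=> Gg; have zm := frac_extension_is_zmod_morphism (gs_inj Gg).
have mm := frac_extension_is_monoid_morphism (gs_inj Gg).
pose f1 := GRing.isZmodMorphism.Build _ _ _ zm.
pose f2 := GRing.isMonoidMorphism.Build _ _ _ mm.
pose s : {rmorphism KV K d -> KV K d} := HB.pack (frac_extension (gs g)) f1 f2.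
by exists s.
Qed.

Lemma gactC g k : g \in G -> ga g (cK k) = cK k.
Proof. by move=> Gg; rewrite /= gactT // gsubstC. Qed.

Lemma gactKV1 x : ga 1%g x = x.
Proof.
have [a [b [b0 ->]]] := fracP x.
have [s es] := gact_rm (group1 G).
by rewrite -es rmorphM fmorphV !es !gactT // !gsubst1.
Qed.

Lemma gactKVM g h x : g \in G -> h \in G -> ga g (ga h x) = ga (h * g)%g x.
Proof.
move=> Gg Gh; have [a [b [b0 ->]]] := fracP x.
have [s es] := gact_rm Gg; have [s' es'] := gact_rm Gh.
have [s2 es2] := gact_rm (groupM Gh Gg).
have H q : s (s' (tofr q)) = s2 (tofr q).
  by rewrite es' gactT // es gactT // es2 gactT ?groupM // gsubstM.
by rewrite -es2 -es' -es !rmorphM !fmorphV !H.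
Qed.

Lemma gact_poly g (u : {poly K}) x : g \in G ->
  ga g (map_poly cK u).[x] = (map_poly cK u).[ga g x].
Proof.
move=> Gg; have [s es] := gact_rm Gg.
rewrite -!es -horner_map -map_poly_comp; congr _.[_].
by apply: eq_map_poly => k; rewrite /= es; apply: (gactC k Gg).
Qed.

Hypothesis faithfulG : mx_faithful rG.

Lemma gact_faithful g h : g \in G -> h \in G -> ga g =1 ga h -> g = h.
Proof.
move=> Gg Gh e; apply: (can_inj (@invgK gT)).
apply: (mx_faithful_inj faithfulG); rewrite ?groupV //.
apply/matrixP => j i; have := e (tofr 'X_i); rewrite !gactT //.
move=> /eqP; rewrite tofrac_eq => /eqP; rewrite !gsubstX.
move/(congr1 (fun q : {mpoly K[d]} => q@_U_(j)%MM)).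
have cf g' : (\sum_(k < d) rG g' k i *: 'X_k)@_U_(j)%MM = rG g' j i.
  rewrite raddf_sum /= (bigD1 j) //= mcoeffZ mcoeffX eqxx mulr1 big1 ?addr0 // => k kj.
  rewrite mcoeffZ mcoeffX; case: eqP => [/mnmP/(_ k)|_]; last by rewrite mulr0.
  by rewrite !mnm1E eqxx eq_sym (negbTE kj).
by rewrite !cf.
Qed.

(** Dedekind's argument: evaluate the relation at [y * x] and subtract [ga g0 y] times the relation
    at [x]. The term of [g0] drops out, and faithfulness provides a [y] on which [h] and [g0]
    differ, so [c h] vanishes by induction. *)
Lemma artin_indep (s : seq gT) (c : gT -> KV K d) : uniq s -> {subset s <= G} ->
  (forall x, \sum_(g <- s) c g * ga g x = 0) -> forall g, g \in s -> c g = 0.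
Proof.
elim: s c => // g0 s IH c /= /andP[g0s us] sG H.
have Gg0 : g0 \in G by apply: sG; rewrite mem_head.
have sG' : {subset s <= G} by move=> g gs; apply: sG; rewrite inE gs orbT.
have cs h : h \in s -> c h = 0.
  move=> hs; have Gh := sG' _ hs.
  have nhg : h <> g0 by move=> e; move: g0s; rewrite -e hs.
  have [y ny] : exists y, ga h y <> ga g0 y.
    apply: NNPP => N; apply: nhg; apply: (gact_faithful Gh Gg0) => y.
    by apply: NNPP => N'; apply: N; exists y.
  have h0 : c h * (ga h y - ga g0 y) = 0.
    apply: (IH (fun g => c g * (ga g y - ga g0 y)) us sG' _ h hs) => x.
    have := H (y * x); have := H x; rewrite !big_cons.
    have -> : \sum_(g <- s) c g * (ga g y - ga g0 y) * ga g x =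
       \sum_(g <- s) c g * ga g (y * x) - ga g0 y * \sum_(g <- s) c g * ga g x.
      rewrite mulr_sumr -sumrB; apply: eq_big_seq => g gs'.
      have [t et] := gact_rm (sG' _ gs'); rewrite -!et rmorphM.
      exact: artin_step1.
    have [t et] := gact_rm Gg0; rewrite -!et rmorphM => H1 H2.
    exact: artin_step2 H1 H2.
  by apply: (mul_sub_eq0 h0).
move=> g; rewrite inE => /orP[/eqP->|]; last exact: cs.
have := H 1; rewrite big_cons big_seq big1 ?addr0; last first.
  by move=> h hs; rewrite cs ?mul0r.
by have [t et] := gact_rm Gg0; rewrite -et rmorph1 mulr1.
Qed.

(** An identically zero trace would be a relation with all coefficients 1 among distinct
    automorphisms. *)
Lemma trace_neq0 : exists x, \sum_(g in G) ga g x != 0.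
Proof.
apply: NNPP => N.
have H x : \sum_(g <- enum G) 1 * ga g x = 0.
  under eq_bigr do rewrite mul1r.
  rewrite big_enum; apply/eqP/negPn/negP => n; apply: N; exists x; exact: n.
have sub : {subset enum G <= G} by move=> g; rewrite mem_enum.
have := @artin_indep (enum G) (fun _ => 1) (enum_uniq _) sub H 1%g.
by rewrite mem_enum group1 => /(_ isT) /eqP; rewrite oner_eq0.
Qed.

End Action.

Section LowerBound.
Variables (K : fieldType) (gT : finGroupType) (G : {group gT}) (d : nat).
Variable rG : mx_representation K G d.

Lemma trdeg_ge1 (E : KV K d -> Prop) t : G :!=: 1%g ->
  faithful_Gsubfield rG E -> trdeg_le E t -> (1 <= t)%N.
Proof.
move=> nG [_ _ fE]; case: t => // tE.
have [g gG g1] := trivgPn _ nG.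
have [x Ex nx] := fE g gG g1; case/eqP: nx.
suff [k ->] : exists k, x = @cKV K d k by apply: gactC.
apply: NNPP => N; have tx : transc (@cKV K d) x.
  by apply: KV_transc => k e; apply: N; exists k.
have [Q Q0 eQ] := tE (fun _ => x) (fun _ => Ex).
have [u u0 eu] := mpoly1_poly (@cKV K d) (fun _ => x) Q0.
by move: u0; rewrite (tx u) ?eqxx // -eu.
Qed.
End LowerBound.

(** * Reduction to a rational function field *)

Lemma is_subfield_closed (K : fieldType) (d : nat) (E : KV K d -> Prop) : is_subfield E -> subfield_closed E.
Proof.
move=> [Ec ED EN EM EV]; split=> //; first by rewrite -(rmorph1 (@cKV K d)); apply: Ec.
by move=> x y Ex Ey; apply: ED => //; apply: EN.
Qed.

Section Generator.
Variables (K : fieldType) (gT : finGroupType) (G : {group gT}) (d : nat).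
Variable rG : mx_representation K G d.
Local Notation ga := (Defs.gact rG).
Local Notation cK := (@cKV K d).
Local Notation tofr := (@FracField.tofrac {mpoly K[d]}).
Variable E : KV K d -> Prop.
Hypothesis fE : faithful_Gsubfield rG E.
Hypothesis tE : trdeg_le E 1.

Let sE : subfield_closed E. Proof. by case: fE => /is_subfield_closed. Qed.
Let Ec k : E (cK k). Proof. by case: fE => -[h _ _ _ _] _ _; apply: h. Qed.
Let EG g x : g \in G -> E x -> E (ga g x). Proof. by case: fE => _ h _; apply: h. Qed.

Section AtLevel.
Variables (N : nat) (f1 : KV K d) (y1 : {fraction {poly K}}).
Hypotheses (Ef1 : E f1) (sf1 : spec (krs K d N) f1 y1) (ny1 : forall k, y1 <> cst K k).

(** Transcendence degree 1 enters here: [f1] and [e] satisfy a polynomial relation, and as the value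
    [y1] of [f1] is transcendental, [spec_kernel0] applies. *)
Lemma spec0_E e : E e -> spec (krs K d N) e 0 -> e = 0.
Proof.
move=> Ee se.
have Ex (i : 'I_2) : E (if i == ord0 then f1 else e) by case: ifP.
have [Q Q0 eQ] := tE Ex.
have [B B0 eB] := mpoly2_poly cK Q0.
have {}eQ : ev2 cK f1 e B = 0 by rewrite -[RHS]eQ; apply/esym/eB.
apply: (@spec_kernel0 K _ _ (@mpolyC d K) (krs K d N) B f1 y1 e) => //.
by move=> u; rewrite (eq_ev _ _ (@krsC K d N)); apply: nonconst_transc.
Qed.

(* The elements of [E] all of whose conjugates are defined under Kronecker substitution:
   a [G]-stable subfield of [E], since no nonzero element of [E] specializes to 0. *)
Definition levelE (e : KV K d) := E e /\ forall g, g \in G -> exists y, spec (krs K d N) (ga g e) y.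

Lemma spec0KV : spec (krs K d N) 0 0.
Proof. by rewrite -(rmorph0 (krs K d N)) -tofrac0; apply: specT. Qed.

Lemma levelE_sub : subfield_closed levelE.
Proof.
split.
- split=> [|g Gg]; first exact: (sub1 sE).
  exists 1; have [s es] := gact_rm rG Gg; rewrite -es rmorph1.
  by rewrite -(rmorph1 (krs K d N)) -tofrac1; apply: specT.
- move=> x y [Ex Ox] [Ey Oy]; split=> [|g Gg]; first exact: (subB sE).
  have [x' sx] := Ox g Gg; have [y' sy] := Oy g Gg.
  have [s es] := gact_rm rG Gg; exists (x' - y'); rewrite -es rmorphB !es.
  by apply: specD => //; apply: specN.
- move=> x y [Ex Ox] [Ey Oy]; split=> [|g Gg]; first exact: (subM sE).
  have [x' sx] := Ox g Gg; have [y' sy] := Oy g Gg.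
  have [s es] := gact_rm rG Gg; exists (x' * y'); rewrite -es rmorphM !es.
  exact: specM.
move=> x [Ex Ox]; split=> [|g Gg]; first exact: (subV sE).
have [x' sx] := Ox g Gg.
have [s es] := gact_rm rG Gg; exists x'^-1; rewrite -es fmorphV !es.
have [x0|x0] := eqVneq x' 0; last exact: specV.
move: sx; rewrite x0 invr0 => sx.
rewrite (spec0_E (EG Gg Ex) sx) invr0; exact: spec0KV.
Qed.

Lemma levelE_spec e : levelE e -> exists y, spec (krs K d N) e y.
Proof. by move=> [_ h]; have := h 1%g (group1 G); rewrite gactKV1. Qed.

Lemma levelE_cst k : levelE (cK k).
Proof.
split=> // g Gg; exists (krs K d N k%:MP); rewrite gactC //; exact: specT.
Qed.

Lemma levelE_G g e : g \in G -> levelE e -> levelE (ga g e).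
Proof.
move=> Gg [Ee Oe]; split=> [|h Gh]; first exact: EG.
by rewrite gactKVM //; apply: Oe; rewrite groupM.
Qed.

(** The values of the elements of [levelE] form a subfield of the rational functions in one
    variable. Its Lueroth generator lifts to [t]; an element [e] and its candidate expression in [t]
    have the same value, so they are equal by [spec0_E]. *)
Lemma level_gen : levelE f1 -> exists t, [/\ levelE t, transc cK t & forall e, levelE e -> ratgen cK t e].
Proof.
move=> Lf1.
pose E' y := exists e, levelE e /\ spec (krs K d N) e y.
have sE' : subfield_closed E'.
  have sL := levelE_sub; split.
  - exists 1; split; first exact: (sub1 sL).
    by rewrite -(rmorph1 (krs K d N)) -tofrac1; apply: specT.
  - move=> x y [e [Le se]] [f [Lf sf]]; exists (e - f); split; first exact: (subB sL).
    by apply: specD => //; apply: specN.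
  - move=> x y [e [Le se]] [f [Lf sf]]; exists (e * f); split; first exact: (subM sL).
    exact: specM.
  move=> x [e [Le se]]; exists e^-1; split; first exact: (subV sL).
  have [x0|x0] := eqVneq x 0; last exact: specV.
  move: se; rewrite x0 invr0 => se; rewrite (spec0_E (proj1 Le) se) invr0.
  exact: spec0KV.
have cE' k : E' (cst K k).
  by exists (cK k); split; [exact: levelE_cst|rewrite -(krsC d N); apply: specT].
have [|t' [[t [Lt st]] nt gt]] := luroth sE' cE'.
  by exists y1 => //; exists f1.
exists t; split=> // [|e Le].
  apply: KV_transc => k ek; apply: (nt k); apply: spec_fun st _.
  by rewrite ek -(krsC d N); apply: specT.
have [y se] := levelE_spec Le.
have [u [v [v0 ey]]] := gt y (ex_intro _ e (conj Le se)).
have su := spec_poly (@mpolyC d K) u st; have sv := spec_poly (@mpolyC d K) v st.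
move: su sv; rewrite !(eq_ev _ _ (@krsC K d N)) => su sv.
have sq := specM su (specV sv v0); rewrite -ey in sq.
exists u, v; split.
  apply/eqP => h; have z := spec0KV.
  by case/eqP: v0; apply: (spec_fun sv); rewrite -/cK h.
apply/eqP; rewrite -subr_eq0; apply/eqP; apply: spec0_E.
  apply: (subB sE); first exact: (proj1 Le).
  apply: (@ratgen_min K (KV K d) cK E t) => //; first exact: (proj1 Lt).
  apply: subdiv; [exact: ratgen_sub| |].
    by apply: sub_horner; [exact: ratgen_sub|move=> i; rewrite coef_map; apply: ratgenC|exact: ratgen_self].
  by apply: sub_horner; [exact: ratgen_sub|move=> i; rewrite coef_map; apply: ratgenC|exact: ratgen_self].
by rewrite -(subrr y); apply: specD => //; apply: specN.
Qed.
End AtLevel.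

(** For faithfulness it suffices to keep one element [X g] moved by each nontrivial [g]. An [N]
    bounding the sizes of all conjugates [ga h (X g)] puts these finitely many elements in
    [levelE N]. *)
Lemma exists_gen : G :!=: 1%g -> exists t, [/\ transc cK t,
  forall g, g \in G -> ratgen cK t (ga g t) & forall g, g \in G -> ga g t = t -> g = 1%g].
Proof.
move=> nG; have Ex g : exists x, E x /\ (g \in G -> g != 1%g -> ga g x != x).
  have [Gg|nGg] := boolP (g \in G); last by exists 1; split=> //; exact: (sub1 sE).
  have [->|g1] := eqVneq g 1%g; first by exists 1; split=> //; exact: (sub1 sE).
  by case: fE => _ _ /(_ g Gg g1) [x Ex nx]; exists x.
have [X hX] := fin_all_exists Ex.
have [w Gw w1] := trivgPn _ nG.
pose sz (x : KV K d) := (msize \n_(repr x) + msize \d_(repr x))%N.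
pose N := (\sum_g \sum_h sz (ga h (X g)))%N.
have szN g h : (sz (ga h (X g)) <= N)%N.
  by rewrite /N (bigD1 g) //= (bigD1 h) //= -addnA leq_addr.
have specX g h : spec (krs K d N) (ga h (X g))
    (krs K d N \n_(repr (ga h (X g))) / krs K d N \d_(repr (ga h (X g)))).
  exists \n_(repr (ga h (X g))), \d_(repr (ga h (X g))); split=> //; last exact: fracE.
  apply: krs_neq0; last exact: denom_ratioP.
  exact: leq_trans (leq_addl _ _) (szN g h).
have LX g : levelE N (X g).
  by split=> [|h Gh]; [case: (hX g)|exists (krs K d N \n_(repr (ga h (X g))) / krs K d N \d_(repr (ga h (X g))))].
have [EXw nXw] := hX w; have {}nXw := nXw Gw w1.
have sf1 := specX w 1%g; rewrite gactKV1 in sf1.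
have szw := szN w 1%g; rewrite gactKV1 in szw.
have ny1 k : krs K d N \n_(repr (X w)) / krs K d N \d_(repr (X w)) <> cst K k.
  apply: krs_nonconst.
  - exact: leq_trans (leq_addr _ _) szw.
  - exact: leq_trans (leq_addl _ _) szw.
  - exact: denom_ratioP.
  by move=> k'; rewrite -fracE => e; case/eqP: nXw; rewrite e; apply: gactC.
have [t [Lt tt gt]] := level_gen EXw sf1 ny1 (LX w).
exists t; split=> // [g Gg|g Gg et]; first by apply/gt/levelE_G.
apply/eqP/negPn/negP => g1.
have [_ /(_ Gg g1) /eqP] := hX g; apply.
have [u [v [v0 ->]]] := gt _ (LX g).
have [s es] := gact_rm rG Gg.
by rewrite -es rmorphM fmorphV !es !gact_poly // et.
Qed.
End Generator.

Arguments cKV : simpl never.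

(** * Moebius transformations *)

Section Mobius.

Lemma spec_map_poly (R : idomainType) (F : fieldType) (s : {rmorphism R -> F}) (q : {poly R}) x y :
  spec s x y -> spec s (map_poly (@FracField.tofrac R) q).[x] (map_poly s q).[y].
Proof.
move=> xy; elim/poly_ind: q => [|q k IH].
  by rewrite !rmorph0 !horner0 -(rmorph0 s) -tofrac0; apply: specT.
rewrite !rmorphD !rmorphM /= !map_polyX !map_polyC !hornerD !hornerM !hornerX !hornerC.
by apply: specD; [apply: specM|apply: specT].
Qed.

Lemma spec_inj0 (R : idomainType) (F : fieldType) (s : {rmorphism R -> F}) x :
  (forall a, s a = 0 -> a = 0) -> spec s x 0 -> x = 0.
Proof.
move=> si [a [b [b0 -> /esym/eqP]]]; rewrite mulf_eq0 invr_eq0 (negbTE b0) orbF.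
by move=> /eqP /si ->; rewrite tofrac0 mul0r.
Qed.

Lemma size2_poly (K : fieldType) (w : {poly K}) : (size w <= 2)%N -> w = w`_1 *: 'X + (w`_0)%:P.
Proof.
move=> sw; apply/polyP => -[|[|i]]; rewrite coefD coefZ coefX coefC /= ?mulr0 ?add0r ?mulr1 ?addr0 //.
by rewrite nth_default // (leq_trans sw).
Qed.

Variables (K F : fieldType) (c : {rmorphism K -> F}).

(* Writing [s = u(t) / v(t)] and [t = w1(s) / w2(s)] in lowest terms, the rational root theorem for
   [u - s v] over [K[s]] forces [w1] and [w2] to be linear. *)
Lemma mobius_of_ratgen (t s : F) : transc c s -> ratgen c t s -> ratgen c s t ->
  exists a b e f, c e * s + c f != 0 /\ t = (c a * s + c b) / (c e * s + c f).
Proof.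
move=> ts /ratgen_coprime [u [v [cuv v0 es]]] /ratgen_coprime [w1 [w2 [cw w20 et]]].
pose ev : {rmorphism {poly K} -> F} := horner_eval s \o map_poly c.
have evi a : ev a = 0 -> a = 0 by apply: ts.
have w2n : w2 != 0 by apply: contra_neq w20 => ->; rewrite rmorph0 horner0.
(* [q] has the root [w1 / w2] in the fraction field of [K[X]], because [X |-> s] is injective for
   transcendental [s]. Its coefficients have degree at most 1 in [X], and the rational root theorem
   passes this bound to [w1] and [w2]. *)
pose q : {poly {poly K}} := map_poly polyC u - 'X%:P * map_poly polyC v.
have qi (i : nat) : q`_i = (u`_i)%:P - v`_i *: 'X.
  by rewrite coefB coefCM !coef_map /= -mul_polyC mulrC.
have sq (i : nat) : (size (q`_i)%R <= 2)%N.
  rewrite qi (leq_trans (size_polyD _ _)) // geq_max size_polyN (leq_trans (size_polyC_leq1 _)) //.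
  by rewrite (leq_trans (size_scale_leq _ _)) // size_polyX.
have qi0 (i : nat) : q`_i = 0 -> u`_i = 0 /\ v`_i = 0.
  rewrite qi => /polyP h; have := h 0%N; have := h 1%N.
  rewrite !coefB !coefZ !coefX !coefC /= mulr0 mulr1 sub0r subr0 => /eqP.
  by rewrite oppr_eq0 => /eqP -> ->.
have z : spec ev (FracField.tofrac w1 / FracField.tofrac w2) t by exists w1, w2.
have root_q : (map_poly (@FracField.tofrac {poly K}) q).[FracField.tofrac w1 / FracField.tofrac w2] = 0.
  apply: (spec_inj0 evi).
  suff <- : (map_poly ev q).[t] = 0 by apply: spec_map_poly.
  have eC (p : {poly K}) : map_poly ev (map_poly polyC p) = map_poly c p.
    rewrite -map_poly_comp; apply: eq_map_poly => k.
    by rewrite /ev /= map_polyC /horner_eval hornerC.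
  have eX : ev 'X = s by rewrite /ev /= map_polyX /horner_eval hornerX.
  have eY : map_poly ev 'X%:P = s%:P by rewrite map_polyC; congr (_%:P).
  have -> : map_poly ev q = map_poly c u - s%:P * map_poly c v.
    by rewrite -eY -!eC -rmorphM -rmorphB.
  rewrite hornerD hornerN hornerM hornerC.
  by rewrite {1}es divfK ?subrr.
have /andP[d2 d1] := ratroot cw w2n root_q.
have q0 : q != 0.
  apply: contra_neq v0 => q0; suff -> : v = 0 by rewrite rmorph0 horner0.
  by apply/polyP => i; rewrite coef0; apply: (proj2 (qi0 i _)); rewrite q0 coef0.
(* The bound on [w1] requires a nonzero constant coefficient: if it were zero, [X] would divide both
   [u] and [v]. *)
have q00 : q`_0 != 0.
  apply/eqP => /qi0 [u0 v00].
  have X1 : 'X %| gcdp u v.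
    have -> : 'X = 'X - 0%:P :> {poly K} by rewrite polyC0 subr0.
    rewrite dvdp_gcd !dvdp_XsubCl /root.
    by rewrite !horner_coef0 u0 v00 eqxx.
  have /size_poly1P [k k0 ek] : size (gcdp u v) == 1%N by [].
  move: X1; rewrite ek -[k%:P]mulr1 mul_polyC dvdpZr // dvdp1 size_polyX //.
have s2 : (size w2 <= 2)%N.
  by rewrite (leq_trans (dvdp_leq _ d2)) ?lead_coef_eq0 // lead_coefE.
have s1 : (size w1 <= 2)%N by rewrite (leq_trans (dvdp_leq q00 d1)).
have e (w : {poly K}) : (size w <= 2)%N -> (map_poly c w).[s] = c w`_1 * s + c w`_0.
  move=> sw; rewrite {1}(size2_poly sw) rmorphD /= map_polyZ map_polyX map_polyC /=.
  by rewrite hornerD hornerZ hornerX hornerC.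
exists w1`_1, w1`_0, w2`_1, w2`_0; rewrite -!e //.
Qed.

End Mobius.

Section Transc.
Variables (K F : fieldType) (c : {rmorphism K -> F}) (t : F).
Hypothesis tt : transc c t.

Lemma transc_quad (e b a f : K) : c e * t ^+ 2 + (c f - c a) * t - c b = 0 ->
  [/\ e = 0, b = 0 & f = a].
Proof.
move=> h; have := tt (u := e *: 'X^2 + (f - a) *: 'X - b%:P).
rewrite rmorphB rmorphD /= !map_polyZ map_polyXn map_polyX map_polyC.
have hx : (c e *: 'X^2 + c (f - a) *: 'X - (c b)%:P).[t] = 0.
  by rewrite -h (rmorphB c) !hornerE.
move=> /(_ hx) /polyP {}h.
have := h 2; have := h 1%N; have := h 0%N.
rewrite !(coefD, coefN, coefZ, coefXn, coefX, coefC, coef0) /=.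
rewrite !(mulr0, mulr1, addr0, add0r, subr0, sub0r, oppr0).
by move=> /eqP; rewrite oppr_eq0 => /eqP -> /eqP; rewrite subr_eq0 => /eqP -> ->.
Qed.

Lemma transc_lin (e b : K) : c e * t - c b = 0 -> e = 0.
Proof.
move=> h; have [] := @transc_quad 0 b 0 e; last by [].
by rewrite rmorph0 mul0r add0r subr0.
Qed.
End Transc.

Section Matrix2.
Variable K : fieldType.

Lemma mx2_eq (A B : 'M[K]_2) : A 0 0 = B 0 0 -> A 0 1 = B 0 1 -> A 1 0 = B 1 0 ->
  A 1 1 = B 1 1 -> A = B.
Proof.
move=> h1 h2 h3 h4; apply/matrixP => i j.
have o2 (l : 'I_2) : l = 0 \/ l = 1.
  by case: l => -[|[|m]] // lt; [left|right]; apply: val_inj.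
by case: (o2 i) => ->; case: (o2 j) => ->.
Qed.

Lemma mulmx2E (A B : 'M[K]_2) i j : (A * B) i j = A i 0 * B 0 j + A i 1 * B 1 j.
Proof. by rewrite [LHS]mxE !big_ord_recl big_ord0 addr0; congr (_ + _ * _); congr (_ _ _); apply: val_inj. Qed.

Definition det2 (A : 'M[K]_2) := A 0 0 * A 1 1 - A 0 1 * A 1 0.

Lemma det2M (A B : 'M[K]_2) : det2 (A * B) = det2 A * det2 B.
Proof. by rewrite /det2 !mulmx2E; ring. Qed.

Lemma sub_scalar_mxE (A : 'M[K]_2) k i j : (A - k%:M) i j = A i j - k *+ (i == j).
Proof. by rewrite !mxE. Qed.

(* Cayley-Hamilton: [N^2 = tr N * N - det N], and [det N = 0] for nilpotent [N]. *)
Lemma nilp_mx2 (N : 'M[K]_2) k : N ^+ k = 0 -> N != 0 ->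
  N 1 1 = - N 0 0 /\ N 0 0 ^+ 2 + N 0 1 * N 1 0 = 0.
Proof.
move=> Nk N0; have d0 : det2 N = 0.
  have : det2 (N ^+ k) = det2 N ^+ k.
    elim: (k) => [|m IH]; last by rewrite !exprS -IH det2M.
    by rewrite !expr0 /det2 !mxE /= mulr0 mulr1 subr0.
  rewrite Nk {1}/det2 !mxE mulr0 subr0 => /esym /eqP.
  by rewrite expf_eq0 => /andP[_ /eqP].
pose tr := N 0 0 + N 1 1.
have sq : N * N = tr *: N.
  move: d0; rewrite /det2 => /eqP; rewrite subr_eq0 => /eqP e.
  apply: mx2_eq; rewrite mulmx2E [RHS]mxE /tr; last 3 first.
  - by ring.
  - by ring.
  - by rewrite -[X in X + _]mulrC -e; ring.
  by rewrite -e; ring.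
have pw m : N ^+ m.+1 = tr ^+ m *: N.
  elim: m => [|m IH]; first by rewrite expr1 expr0 scale1r.
  by rewrite exprS IH -scalerAr sq scalerA exprSr.
have tr0 : tr = 0.
  case: k Nk => [|k]; first by rewrite expr0 => /eqP; rewrite oner_eq0.
  rewrite pw => /eqP; rewrite scaler_eq0 (negbTE N0) orbF expf_eq0 => /andP[_ /eqP //].
have e : N 1 1 = - N 0 0 by apply/eqP; rewrite -addr_eq0 addrC; apply/eqP.
split=> //; move: d0; rewrite /det2 e => h; rewrite -[RHS]oppr0 -h; ring.
Qed.

Lemma frob_scalar_mx (p : nat) (A : 'M[K]_2) (k : K) : p \in [pchar K] ->
  A ^+ p = (k ^+ p)%:M -> (A - k%:M) ^+ p = 0.
Proof.
move=> pK Ap; have pM : p \in [pchar 'M[K]_2].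
  exact: (rmorph_pchar (@scalar_mx K 2) pK).
have cA : GRing.comm A (- k%:M) by apply: GRing.commrN; apply: comm_mx_scalar.
rewrite -(pFrobenius_autE pM) pFrobenius_autD_comm // pFrobenius_autN !pFrobenius_autE Ap.
by rewrite -rmorphXn subrr.
Qed.
End Matrix2.

Lemma mobius_step (F : fieldType) (a b e f t wt x y : F) :
  wt * (e * t + f) = a * t + b ->
  (x * a + y * e) * t + (x * b + y * f) = (e * t + f) * (x * wt + y).
Proof. by move=> h; transitivity (x * (a * t + b) + y * (e * t + f)); [ring|rewrite -h; ring]. Qed.

Lemma quad_step (F : fieldType) (a b e f t n : F) : a * t + b = n * t -> e * t + f = n ->
  e * t ^+ 2 + (f - a) * t - b = 0.
Proof.
move=> h e1; rewrite -e1 in h.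
by transitivity ((e * t + f) * t - (a * t + b)); [ring|rewrite h subrr].
Qed.

Lemma div_div_cancel (F : fieldType) (k b t : F) : b != 0 -> k != 0 -> t = b / k * (k / b * t).
Proof. by move=> b0 k0; field; rewrite b0. Qed.

Lemma translation_step1 (F : fieldType) (k b t wt : F) : k != 0 -> b != 0 ->
  wt * k = k * t + b -> k / b * wt = k / b * t + 1.
Proof.
move=> k0 b0 h; have -> : k / b * wt = (wt * k) / b by field.
by rewrite h; field.
Qed.

Lemma inv_step (F : fieldType) (k e al t : F) : k != 0 -> e * t - al != 0 -> e != 0 ->
  t = (k / (k / (e * t - al)) + al) / e.
Proof. by move=> k0 n0 e0; field; rewrite e0 n0 k0. Qed.

(** The point [al / e] is the double fixed point of [w]: multiplied by [e], the fixed-point equation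
    reads [(e t - al)^2 = 0]. The coordinate [k / (e t - al)] sends it to infinity. *)
Lemma translation_step2 (F : fieldType) (k e al b t wt : F) : k != 0 ->
  e * t + (k - al) != 0 -> e * t - al != 0 -> al ^+ 2 + b * e = 0 ->
  wt * (e * t + (k - al)) = (k + al) * t + b ->
  k / (e * wt - al) = k / (e * t - al) + 1.
Proof.
move=> k0 n0 n1 q h.
have ewt : (e * wt - al) * (e * t + (k - al)) = k * (e * t - al).
  transitivity (e * (wt * (e * t + (k - al))) - al * (e * t + (k - al))); first by ring.
  rewrite h; transitivity (k * (e * t - al) + (al ^+ 2 + b * e)); first by ring.
  by rewrite q addr0.
have n2 : e * wt - al != 0.
  apply: contraNneq n1 => h0; move/eqP: ewt.
  by rewrite h0 mul0r eq_sym mulf_eq0 (negbTE k0).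
apply: (mulIf n2); rewrite divfK // mulrDl mul1r.
apply: (mulIf n0); rewrite mulrDl -mulrA ewt.
by field.
Qed.

Section Unipotent.
Variables (K : fieldType) (gT : finGroupType) (G : {group gT}) (d : nat).
Variable rG : mx_representation K G d.
Local Notation ga := (Defs.gact rG).
Local Notation cK := (@cKV K d).

(* [K(t)] is a faithful [G]-stable subfield of transcendence degree 1. *)
Definition generator (t : KV K d) := [/\ transc cK t,
  forall g, g \in G -> ratgen cK t (ga g t) & forall g, g \in G -> ga g t = t -> g = 1%g].

Lemma ratgen_ga g t e : g \in G -> ratgen cK t e -> ratgen cK (ga g t) (ga g e).
Proof.
move=> Gg [u [v [v0 ->]]]; have [s es] := gact_rm rG Gg.
have eg (p : {poly K}) : (map_poly cK p).[ga g t] = s (map_poly cK p).[t].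
  by rewrite es gact_poly.
exists u, v; rewrite !eg -es; split; first by rewrite fmorph_eq0.
exact: fmorph_div.
Qed.

Lemma generator_trans t t' : generator t -> ratgen cK t t' -> ratgen cK t' t -> generator t'.
Proof.
move=> [tt tg tf] h h'; split.
- apply: KV_transc => k e; move: h'; rewrite e => -[u [v [v0 et]]].
  have ek (p : {poly K}) : (map_poly cK p).[cK k] = cK p.[k] by rewrite horner_map.
  move: et; rewrite !ek -fmorphV -rmorphM => et.
  have := tt ('X - (u.[k] / v.[k])%:P).
  rewrite rmorphB /= map_polyX map_polyC hornerD hornerN hornerX hornerC et subrr.
  by move=> /(_ erefl) /eqP; rewrite polyXsubC_eq0.
- move=> g Gg; apply: (ratgen_trans h').
  by apply: (ratgen_trans (tg g Gg)); apply: ratgen_ga.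
move=> g Gg e; apply: tf => //; move: h' => [u [v [v0 ->]]].
have [s es] := gact_rm rG Gg.
by rewrite -es rmorphM fmorphV !es !gact_poly // e.
Qed.

(** Applying [g] to [g^-1 t], an element of [K(t)], gives [t] in [K(g t)]; so [t] and [g t] generate
    the same field. *)
Lemma generator_mobius t g : generator t -> g \in G -> exists a b e f : K,
  cK e * t + cK f != 0 /\ ga g t * (cK e * t + cK f) = cK a * t + cK b.
Proof.
move=> [tt tg _] Gg; have Gg' : g^-1%g \in G by rewrite groupV.
have h2 : ratgen cK (ga g t) t.
  have := ratgen_ga Gg (tg _ Gg').
  by rewrite gactKVM // mulVg gactKV1.
have [a [b [e [f [n0 et]]]]] := mobius_of_ratgen tt h2 (tg g Gg).
exists a, b, e, f; split=> //; rewrite et.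
exact: (divfK n0).
Qed.

Section UnipotentElement.
Variables (p : nat) (w : gT) (t : KV K d).
Hypotheses (pK : p \in [pchar K]) (Gw : w \in G) (wp : (w ^+ p = 1)%g) (w1 : w != 1%g).
Hypothesis gt : generator t.
Hypothesis norm_pth : forall D mu, D != 0 -> \prod_(i < p) ga (w ^+ i)%g D = cK mu ->
  exists k, mu = k ^+ p.

(* With [y] the column [(t, 1)] and [D] the denominator of [w t], [A y = D * w(y)];
   iterating, [A^k y = N_k * w^k(y)]. *)
Lemma mobius_iter (A : 'M[K]_2) : let D := cK (A 1 0) * t + cK (A 1 1) in
  ga w t * D = cK (A 0 0) * t + cK (A 0 1) -> forall k,
  let N := \prod_(i < k) ga (w ^+ i)%g D in
  cK ((A ^+ k) 0 0) * t + cK ((A ^+ k) 0 1) = N * ga (w ^+ k)%g t /\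
  cK ((A ^+ k) 1 0) * t + cK ((A ^+ k) 1 1) = N.
Proof.
move=> D eD; elim=> [|k [IH1 IH2]] /=.
  rewrite big_ord0 !expr0 !mxE /= !rmorph0 !rmorph1 mul0r mul1r add0r addr0.
  by rewrite expg0 gactKV1 mul1r.
have [s es] := gact_rm rG Gw.
have sK l : s (cK l) = cK l by rewrite es gactC.
have eN : \prod_(i < k.+1) ga (w ^+ i)%g D = D * s (\prod_(i < k) ga (w ^+ i)%g D).
  rewrite big_ord_recl expg0 gactKV1 rmorph_prod; congr (_ * _).
  by apply: eq_bigr => i _; rewrite es gactKVM ?groupX // -expgSr.
have step i : cK ((A ^+ k.+1) i 0) * t + cK ((A ^+ k.+1) i 1) =
    D * s (cK ((A ^+ k) i 0) * t + cK ((A ^+ k) i 1)).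
  rewrite exprSr !mulmx2E (rmorphD s) (rmorphM s) !sK es.
  rewrite !(rmorphD cK) !(rmorphM cK).
  exact: (mobius_step _ _ eD).
split; last by rewrite step IH2 eN.
rewrite step IH1 eN (rmorphM s) mulrA; congr (_ * _).
rewrite es expgSr; exact: (gactKVM rG t Gw (groupX k Gw)).
Qed.

(* Hence [A^p] is the scalar [N_p], which is a [p]-th power [k^p] by hypothesis, and [A - k] is
   nilpotent: its kernel is a [K]-rational fixed point of [w], which is moved to infinity. *)
Lemma unipotent_gen : exists t', generator t' /\ ga w t' = t' + 1.
Proof.
have [a [b [e [f [n0 eD]]]]] := generator_mobius gt Gw.
have [tt tg tf] := gt.
pose A : 'M[K]_2 := \matrix_(i, j) (if i == 0 then (if j == 0 then a else b)
                                    else (if j == 0 then e else f)).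
have A00 : A 0 0 = a by rewrite mxE.
have A01 : A 0 1 = b by rewrite mxE.
have A10 : A 1 0 = e by rewrite mxE.
have A11 : A 1 1 = f by rewrite mxE.
have := @mobius_iter A; rewrite A00 A01 A10 A11 => /(_ eD p) [].
set N := \prod_(i < p) _; rewrite wp gactKV1 => h1 h2.
(* Since [w^p = 1], the rows of [A^p] applied to [(t, 1)] give [N t] and [N]. Eliminating [N] leaves
   a quadratic equation for the transcendental [t], so all its coefficients vanish and [A^p] is
   scalar. *)
have [e10 e01 e11] : [/\ (A ^+ p) 1 0 = 0, (A ^+ p) 0 1 = 0 & (A ^+ p) 1 1 = (A ^+ p) 0 0].
  exact: (transc_quad tt (quad_step h1 h2)).
have p0 : (0 < p)%N by apply: prime_gt0; case/andP: pK.
have [k ek] : exists k, (A ^+ p) 1 1 = k ^+ p.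
  by apply: (norm_pth n0); rewrite -/N -h2 e10 rmorph0 mul0r add0r.
have Ap : A ^+ p = (k ^+ p)%:M.
  by apply: mx2_eq; rewrite ?e10 ?e01 -?e11 ?ek !mxE.
have N0 : N != 0.
  apply/prodf_neq0 => i _; have [s es] := gact_rm rG (groupX i Gw).
  by rewrite -es fmorph_eq0.
have k0 : k != 0.
  apply: contraNneq N0 => k0; rewrite -h2 e10 ek k0 expr0n.
  by rewrite -(prednK p0) /= rmorph0 mul0r add0r.
pose B := A - k%:M.
have B0 : B != 0.
  apply: contraNneq w1 => /eqP; rewrite subr_eq0 => /eqP eA.
  apply/eqP; apply: tf => //.
  move: A00 A01 A10 A11; rewrite eA !mxE /= => ea eb ee ef.
  move: eD; rewrite -ea -eb -ee -ef rmorph0 mul0r add0r addr0 => /eqP.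
  by rewrite mulrC (inj_eq (mulfI _)) ?fmorph_eq0 // => /eqP.
have [q1 q2] := nilp_mx2 (frob_scalar_mx pK Ap) B0.
pose al := B 0 0.
have BE i j : B i j = A i j - k *+ (i == j) by apply: sub_scalar_mxE.
have ea : a = k + al by rewrite /al BE A00 eqxx mulr1n addrC subrK.
have ef : f = k - al by rewrite /al -q1 -/B BE A11 eqxx mulr1n addrC subrK.
have B01 : B 0 1 = b by rewrite BE A01 subr0.
have B10 : B 1 0 = e by rewrite BE A10 subr0.
move: q2; rewrite B01 B10 -/al => q2.
have ckn0 : cK k != 0 by rewrite fmorph_eq0.
have [s es] := gact_rm rG Gw.
have sK l : s (cK l) = cK l by rewrite es gactC.
have rc l : ratgen cK t (cK l) by apply: ratgenC.
have rt := ratgen_self cK t.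
have sr := ratgen_sub cK.
(* If [e = 0] the fixed point is already at infinity, and nilpotency leaves [w t = t + b / k];
   rescaling makes the step 1. *)
have [e0|en0] := eqVneq e 0.
  have al0 : al = 0.
    by move: q2; rewrite e0 mulr0 addr0 => /eqP; rewrite sqrf_eq0 => /eqP.
  have b0 : b != 0.
    apply: contraNneq w1 => b0; apply/eqP; apply: tf => //.
    move: eD; rewrite ea ef e0 al0 b0 rmorph0 mul0r add0r addr0 addr0 subr0 mulrC => /eqP.
    by rewrite (inj_eq (mulfI _)) // => /eqP.
  have cb0 : cK b != 0 by rewrite fmorph_eq0.
  exists (cK k / cK b * t); split.
    apply: (generator_trans gt).
      by apply: (subM (sr t)) => //; apply: (subdiv (sr t)).
    set t' := _ * t; have -> : t = cK b / cK k * t' by exact: (div_div_cancel _ cb0 ckn0).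
    apply: (subM (sr t')); last exact: ratgen_self.
    by apply: (subdiv (sr t')); apply: ratgenC.
  rewrite -es !rmorphM fmorphV !sK es.
  move: eD; rewrite ea ef e0 al0 rmorph0 mul0r add0r addr0 subr0 => eD.
  exact: (translation_step1 ckn0 cb0 eD).
have ce0 : cK e != 0 by rewrite fmorph_eq0.
have n1 : cK e * t - cK al != 0.
  by apply: contra_neq en0 => /(transc_lin tt).
exists (cK k / (cK e * t - cK al)); split.
  apply: (generator_trans gt).
    apply: (subdiv (sr t)) => //; apply: (subB (sr t)) => //.
    by apply: (subM (sr t)).
  set t' := _ / _.
  have -> : t = (cK k / t' + cK al) / cK e by exact: (inv_step ckn0 n1 ce0).
  apply: (subdiv (sr t')); last exact: ratgenC.
  apply: (subD (sr t')); last exact: ratgenC.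
  by apply: (subdiv (sr t')); [exact: ratgenC|exact: ratgen_self].
rewrite -es rmorphM fmorphV rmorphB rmorphM !sK es.
have q3 : cK al ^+ 2 + cK b * cK e = 0 by rewrite -rmorphXn -rmorphM -rmorphD q2 rmorph0.
move: eD n0; rewrite ea ef !rmorphD !rmorphN => eD n0.
exact: (translation_step2 ckn0 n0 n1 q3 eD).
Qed.
End UnipotentElement.
End Unipotent.

(** * Unitriangular elements and norms *)

Section Triangular.
Variable K : fieldType.

Lemma conj_expmx d (B N : 'M[K]_d) k : B \in unitmx ->
  (B *m N *m invmx B) ^+ k = B *m N ^+ k *m invmx B.
Proof.
move=> uB; elim: k => [|k IH]; first by rewrite !expr0 mulmx1 mulmxV.
by rewrite !exprS IH -![_ * _]/(_ *m _) -!mulmxA; congr (_ *m (_ *m _)); rewrite mulKmx.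
Qed.

Lemma invmx_mul d (A B : 'M[K]_d) : A \in unitmx -> B \in unitmx ->
  invmx (A *m B) = invmx B *m invmx A.
Proof.
move=> uA uB; have uAB : A *m B \in unitmx by rewrite unitmx_mul uA.
by apply: (can_inj (mulKmx uAB)); rewrite mulmxV // mulmxA mulmxK // mulmxV.
Qed.

Lemma sub1mxE d (A : 'M[K]_d) i j : (A - 1%:M) i j = A i j - (i == j)%:R.
Proof. by rewrite !mxE. Qed.

Lemma expmx_pchar d (M : 'M[K]_d) p : p \in [pchar K] -> M ^+ p = 1%:M -> (M - 1%:M) ^+ p = 0.
Proof.
move=> pK; case: d M => [|d] M Mp; first exact: flatmx0.
have pM : p \in [pchar 'M[K]_d.+1] := rmorph_pchar (@scalar_mx K d.+1) pK.
have cM : GRing.comm M (- 1%:M) by apply: GRing.commrN; apply: GRing.commr1.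
rewrite -(pFrobenius_autE pM) pFrobenius_autD_comm // pFrobenius_autN !pFrobenius_autE Mp.
by rewrite expr1n subrr.
Qed.

(** Induction on the size: a vector of the left kernel, completed to a basis by [row_ebase], makes
    the first row zero, and the lower right block is again nilpotent. The outcome is strictly lower
    triangular. *)
Lemma nilp_trig d (N : 'M[K]_d) k : N ^+ k = 0 -> exists2 B, B \in unitmx &
  forall i j : 'I_d, (i <= j)%N -> (B *m N *m invmx B) i j = 0.
Proof.
elim: d N => [|d IH] N Nk; first by exists 1%:M; [exact: unitmx1|case].
have [v vN v0] : exists2 v : 'rV_(1 + d), v *m N = 0 & v != 0.
  have : kermx N != 0.
    rewrite kermx_eq0 row_free_unit; apply/negP => uN.
    have : N ^+ k \is a GRing.unit by rewrite unitrX.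
    by rewrite Nk unitr0.
  by case/rowV0Pn => v /sub_kermxP vN v0; exists v.
pose B0 : 'M_(1 + d) := row_ebase v; have uB0 : B0 \in unitmx by apply: row_ebase_unit.
have u0 : usubmx B0 *m N = 0.
  have eu : usubmx B0 = pid_mx 1 *m B0.
    rewrite -[B0 in RHS]vsubmxK pid_mx_row mul_row_col mul0mx addr0.
    by rewrite mul1mx.
  rewrite eu; have uc := col_ebase_unit v.
  have := vN; rewrite -{1}[v]mulmx_ebase rank_rV v0 -!mulmxA.
  by move/(congr1 (mulmx (invmx (col_ebase v)))); rewrite mulKmx // mulmx0 mulmxA.
pose N' : 'M_(1 + d) := B0 *m N *m invmx B0.
have uN' : usubmx N' = 0.
  by rewrite /N' -[B0]vsubmxK !mul_col_mx col_mxKu vsubmxK u0 mul0mx.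
have bN' : N' = block_mx 0 0 (dlsubmx N') (drsubmx N').
  by rewrite -{1}[N']submxK /ulsubmx /ursubmx uN' !linear0.
have N'k : N' ^+ k = 0.
  by have := @conj_expmx _ B0 N k uB0; rewrite Nk mulmx0 mul0mx.
have [B1 uB1 tB1] : exists2 B, B \in unitmx &
   forall i j : 'I_d, (i <= j)%N -> (B *m drsubmx N' *m invmx B) i j = 0.
  apply: IH.
  (* Powers of a block lower triangular matrix are computed blockwise on the diagonal, which passes
     nilpotency to the corner. *)
  have pw m : exists X Y, N' ^+ m = block_mx X 0 Y (drsubmx N' ^+ m) :> 'M_(1 + d).
    elim: m => [|m [X [Y e]]]; first by exists 1%:M, 0; rewrite !expr0 -scalar_mx_block.
    exists 0, (dlsubmx N' *m X + drsubmx N' *m Y).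
    rewrite !exprS e {1}bN' [LHS](mulmx_block (n1 := 1) (n2 := d)).
    by rewrite !mul0mx !mulmx0 !add0r.
  have [X [Y e]] := pw k; rewrite N'k in e.
  by have := congr1 (@drsubmx _ 1 d 1 d) e; rewrite block_mxKdr => <-; apply/matrixP => i j; rewrite !mxE.
have uB2 : (block_mx 1%:M 0 0 B1 : 'M_(1 + d)) \in unitmx.
  by rewrite unitmxE det_ublock det1 mul1r.
exists (block_mx 1%:M 0 0 B1 *m B0); first by rewrite unitmx_mul uB2.
have -> : block_mx 1%:M 0 0 B1 *m B0 *m N *m invmx (block_mx 1%:M 0 0 B1 *m B0) =
   block_mx 0 0 (B1 *m dlsubmx N') (B1 *m drsubmx N' *m invmx B1) :> 'M_(1 + d).
  have iB2 : invmx (block_mx 1%:M 0 0 B1) = block_mx 1%:M 0 0 (invmx B1) :> 'M_(1 + d).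
    apply: (can_inj (mulKmx uB2)); rewrite mulmxV // mulmx_block.
    by rewrite !mul0mx !mulmx0 !mul1mx !addr0 add0r mulmxV // -scalar_mx_block.
  rewrite invmx_mul // iB2.
  transitivity (block_mx 1%:M 0 0 B1 *m N' *m block_mx 1%:M 0 0 (invmx B1) : 'M_(1 + d)).
    by rewrite /N' !mulmxA.
  rewrite bN' !mulmx_block !mul0mx !mulmx0 !mulmx1 ?mul1mx !addr0 !add0r.
  by rewrite block_mxKdl block_mxKdr mul0mx.
move=> i j ij; rewrite -[i](splitK (m := 1)) -[j](splitK (m := 1)).
case: splitP => i' ei; case: splitP => j' ej /=.
- by apply: etrans (block_mxEul _ _ _ _ _ _) _; rewrite mxE.
- by apply: etrans (block_mxEur _ _ _ _ _ _) _; rewrite mxE.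
- by move: ij; rewrite ei ej leqNgt; case: j' {ej} => -[].
by apply: etrans (block_mxEdr _ _ _ _ _ _) _; rewrite tB1 //; move: ij; rewrite ei ej leq_add2l.
Qed.
End Triangular.

(** * Substitutions that preserve leading coefficients *)

Section LeadingCoefficient.
Variables (K : fieldType) (d : nat) (s : {rmorphism {mpoly K[d]} -> {mpoly K[d]}}).
Hypothesis sC : forall k, s k%:MP = k%:MP.
Hypothesis sX : forall i, mlead (s 'X_i) = U_(i)%MM /\ mleadc (s 'X_i) = 1.

Let sX0 i : s 'X_i != 0.
Proof. by rewrite -mleadc_eq0 (proj2 (sX i)) oner_eq0. Qed.

Lemma mlead_subst_mon m : mlead (s 'X_[m]) = m /\ mleadc (s 'X_[m]) = 1.
Proof.
have sP i : s 'X_i ^+ m i != 0 by rewrite expf_neq0.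
have e : s 'X_[m] = \prod_(i < d) s 'X_i ^+ m i.
  rewrite (mpolyXE _ 1%g) rmorph_prod; apply: eq_bigr => i _.
  by rewrite perm1 rmorphXn.
have lm : mlead (s 'X_[m]) = m.
  rewrite e mlead_prod => [|i _ _ //]; rewrite [RHS]multinomUE_id.
  by apply: eq_bigr => i _; rewrite mleadX // (proj1 (sX i)).
split=> //; rewrite e -[X in _@_X]/(mlead _).
rewrite mleadc_prod_proper; last first.
  by move=> i _ _; apply/lregP; rewrite mleadc_eq0.
rewrite big1 // => i _.
rewrite mleadcX_proper; last by apply/lregP; rewrite mleadc_eq0.
by rewrite (proj2 (sX i)) expr1n.
Qed.

(** Induction along the monomial order: the image of the leading term keeps its leading monomial and
    coefficient, and the image of the rest has a smaller leading monomial and cannot disturb it. *)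
Lemma mlead_subst q : mlead (s q) = mlead q /\ mleadc (s q) = mleadc q.
Proof.
elim/mleadrect: q => q IH; have [->|q0] := eqVneq q 0; first by rewrite rmorph0.
pose a := mleadc q; pose m := mlead q.
have a0 : a != 0 by rewrite mleadc_eq0.
have es : s (a *: 'X_[m]) = a *: s 'X_[m] by rewrite -!mul_mpolyC rmorphM sC.
have [lm cm] := mlead_subst_mon m.
have l1 : mlead (s (a *: 'X_[m])) = m by rewrite es mleadZ.
have c1 : (s (a *: 'X_[m]))@_m = a 
  by have := cm; rewrite es mcoeffZ lm => ->; rewrite mulr1.
pose r := q - a *: 'X_[m].
have er : q = a *: 'X_[m] + r by rewrite addrC subrK.
have [r0|r0] := eqVneq r 0.
  by move: er; rewrite r0 addr0 => e; rewrite {1 3}e l1 -/m; split=> //; rewrite {1}e c1.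
have lr : (mlead r < m)%O.
  have lt : mlead r != m.
    apply: contraNneq r0 => e; rewrite -mleadc_eq0 e /r mcoeffB mcoeffZ mcoeffX eqxx mulr1.
    by rewrite subrr.
  rewrite lt_neqAle lt /= (le_trans (mleadB_le _ _)) // leUx lexx /=.
  by rewrite mleadZ // mleadXm.
have [l2 _] := IH r lr.
have lq : mlead (s q) = m by rewrite er rmorphD mleadDl ?l1 // l2.
split=> //; rewrite lq er rmorphD mcoeffD c1 mcoeff_gt_mlead ?addr0; last by rewrite l2.
by rewrite -er.
Qed.
End LeadingCoefficient.

Section NormCondition.
Variables (K : fieldType) (gT : finGroupType) (G : {group gT}) (d : nat).
Variable rG : mx_representation K G d.
Local Notation ga := (Defs.gact rG).
Local Notation cK := (@cKV K d).
Local Notation tofr := (@FracField.tofrac {mpoly K[d]}).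
Variables (w : gT) (p : nat).
Hypotheses (Gw : w \in G).
Hypothesis trig : forall i j : 'I_d, (i <= j)%N -> rG (w^-1)%g i j = (i == j)%:R.

(** [w] sends [x_i] to [x_i] plus a combination of the [x_j] with [j > i], which are smaller in the
    monomial order. *)
Lemma gsubst_lead q : mleadc (gsubst rG w q) = mleadc q.
Proof.
suff H i : mlead (gsubst rG w 'X_i) = U_(i)%MM /\ mleadc (gsubst rG w 'X_i) = 1.
  exact: (proj2 (@mlead_subst K d (gsubst_rm rG w) (gsubstC rG w) H q)).
rewrite gsubstX (bigD1 i) //= trig // eqxx scale1r.
set r := \sum_(j < d | _) _.
have [r0|r0] := eqVneq r 0; first by rewrite r0 addr0 mleadXm mcoeffX eqxx.
have lr : (mlead r < U_(i)%MM)%O.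
  have := mlead_supp r0; rewrite mcoeff_msupp => nz.
  have [j ji ej] : exists2 j : 'I_d, (i < j)%N & mlead r = U_(j)%MM.
    apply: NNPP => N; case/negP: nz; rewrite raddf_sum /= big1 // => j ji.
    rewrite mcoeffZ mcoeffX; case: eqP => [e|_]; last by rewrite mulr0.
    have [le|lt] := leqP j i; first by rewrite trig // (negbTE ji) mul0r.
    by case: N; exists j.
  rewrite ej; apply/ltmcP; first by rewrite !mdeg1.
  exists i => [k ki|]; rewrite !mnm1E.
    by rewrite -!val_eqE /= !gtn_eqF // (ltn_trans ki).
  by rewrite eqxx -val_eqE /= gtn_eqF.
rewrite mleadDl ?mleadXm //; split=> //.
by rewrite mcoeffD mcoeffX eqxx mcoeff_gt_mlead ?addr0.
Qed.

(* When [w] is unitriangular it preserves leading coefficients, so comparing them in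
   [prod_i w^i(D) = mu] exhibits [mu] as a [p]-th power. *)
Lemma norm_pth_of_trig D mu : D != 0 -> \prod_(i < p) ga (w ^+ i)%g D = cK mu ->
  exists k, mu = k ^+ p.
Proof.
have [a [b [b0 ->]]] := fracP D => D0 e.
have a0 : a != 0.
  by apply: contraNneq D0 => ->; rewrite tofrac0 mul0r.
have lcw q i : mleadc (gsubst rG (w ^+ i)%g q) = mleadc q.
  elim: i => [|i IH]; first by rewrite expg0 gsubst1.
  by rewrite expgSr -gsubstM ?groupX // gsubst_lead.
have nz q i : q != 0 -> gsubst rG (w ^+ i)%g q != 0.
  by move=> q0; rewrite -mleadc_eq0 lcw mleadc_eq0.
have ei i : ga (w ^+ i)%g (tofr a / tofr b) =
    tofr (gsubst rG (w ^+ i)%g a) / tofr (gsubst rG (w ^+ i)%g b).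
  have [s es] := gact_rm rG (groupX i Gw).
  by rewrite -es fmorph_div !es !gactT ?groupX.
have {}e : \prod_(i < p) gsubst rG (w ^+ i)%g a = mu%:MP * \prod_(i < p) gsubst rG (w ^+ i)%g b.
  have pb0 : tofr (\prod_(i < p) gsubst rG (w ^+ i)%g b) != 0.
    by rewrite tofrac_eq0; apply/prodf_neq0 => i _; apply: nz.
  apply/eqP; rewrite -tofrac_eq tofracM -[tofr mu%:MP]/(cK mu) -e.
  rewrite (eq_bigr _ (fun (i : 'I_p) _ => ei i)).
  rewrite prodf_div -!rmorph_prod; apply/eqP.
  exact: esym (divfK pb0 _).
have lcp q : q != 0 -> mleadc (\prod_(i < p) gsubst rG (w ^+ i)%g q) = mleadc q ^+ p.
  move=> q0; rewrite mleadc_prod_proper => [|i _ _]; last by apply/lregP; rewrite mleadc_eq0 nz.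
  by under eq_bigr do rewrite lcw; rewrite big_const_ord iter_mulr_1.
have := congr1 (fun q : {mpoly K[d]} => mleadc q) e.
rewrite /= lcp // mul_mpolyC mleadcZE lcp // => h.
exists (mleadc a / mleadc b); rewrite expr_div_n h mulfK //.
by rewrite expf_neq0 // mleadc_eq0.
Qed.
End NormCondition.

(** In characteristic [p] the matrix of [w^-1] minus 1 has zero [p]-th power, so a conjugate of the
    regular representation makes it triangular. The inverse appears because [gsubst] for [w] uses
    the matrix of [w^-1]. *)
Lemma exists_trig_repr (K : fieldType) (gT : finGroupType) (G : {group gT}) (p : nat) (w : gT) :
  p \in [pchar K] -> w \in G -> (w ^+ p = 1)%g ->
  exists d (rG : mx_representation K G d), mx_faithful rG /\
    forall i j : 'I_d, (i <= j)%N -> rG (w^-1)%g i j = (i == j)%:R.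
Proof.
move=> pK Gw wp; pose r0 := regular_repr K G.
have Gw' : (w^-1)%g \in G by rewrite groupV.
have np : (r0 (w^-1)%g - 1%:M) ^+ p = 0.
  apply: (expmx_pchar pK).
  have pw i : r0 (w^-1)%g ^+ i = r0 ((w^-1) ^+ i)%g.
    elim: i => [|i IH]; first by rewrite expr0 expg0 repr_mx1.
    by rewrite exprS IH expgS repr_mxM // groupX.
  by rewrite pw expgVn wp invg1 repr_mx1.
have [B uB tB] := nilp_trig np.
exists #|G|, (rconj_repr r0 uB); rewrite conj_mx_faithful; split; first exact: regular_mx_faithful.
move=> i j ij; rewrite rconj_mxE; have := tB i j ij.
rewrite mulmxBr mulmxBl mulmx1 mulmxV // sub1mxE => /eqP.
by rewrite subr_eq0 => /eqP.
Qed.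

(** * Necessity of the conditions *)

Section FpSpan.
Variables (K : fieldType) (p : nat).
Hypothesis pK : p \in [pchar K].

Let p_pr : prime p. Proof. by case/andP: pK. Qed.
Let p_gt0 : (0 < p)%N. Proof. exact: prime_gt0. Qed.

Lemma natr_modp a : (a %% p)%:R = a%:R :> K.
Proof. by rewrite [in RHS](divn_eq a p) natrD natrM (pcharf0 pK) mulr0 add0r. Qed.

Definition Fp_comb k (x : 'I_k -> K) (c : {ffun 'I_k -> 'I_p}) : K := \sum_(i < k) (c i)%:R * x i.

Lemma Fp_combP k (x : 'I_k -> K) (c : 'I_k -> nat) :
  exists e : {ffun 'I_k -> 'I_p}, \sum_(i < k) (c i)%:R * x i = Fp_comb x e.
Proof.
exists [ffun i => Ordinal (ltn_pmod (c i) p_gt0)].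
by apply: eq_bigr => i _; rewrite ffunE /= natr_modp.
Qed.

Lemma natr_inv_modp a : (0 < a < p)%N -> exists m, m%:R * a%:R = -1 :> K.
Proof.
move=> /andP[a0 ap]; have co : coprime a p.
  by rewrite coprime_sym prime_coprime // gtnNdvd.
case/(coprimeP _ a0): co => -[u v] /= e.
(* [u] inverts [a] modulo [p], and [p.-1] stands for -1, as coefficients are natural numbers. *)
exists (u * p.-1)%N; have e' : (u * a)%N = (1 + v * p)%N.
  by rewrite -e subnK // ltnW // -subn_gt0 e.
have h : (u * a)%:R = 1 :> K by rewrite e' natrD natrM (pcharf0 pK) mulr0 addr0.
have h1 : p.-1%:R = -1 :> K.
  by apply/eqP; rewrite -addr_eq0 natr1 prednK // (pcharf0 pK).
by rewrite natrM mulrAC -natrM h mul1r h1.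
Qed.

(** Counting: [k < r] elements have at most [p^k] combinations, fewer than [p^r], so some element of
    [C] extends an independent family. *)
Lemma Fp_dim_of_seq (r : nat) (C : seq K) : uniq C -> size C = (p ^ r)%N -> Fp_dim_ge K p r.
Proof.
move=> uC sC; suff H k : (k <= r)%N -> exists x : 'I_k -> K, Fp_free p x by exact: H.
elim: k => [|k IH] kr; first by exists (fun _ => 0) => c _ _ [].
have [x fx] := IH (ltnW kr).
pose S := [seq Fp_comb x c | c : {ffun 'I_k -> 'I_p}].
have [y yC yS] : exists2 y, y \in C & y \notin S.
  apply: NNPP => N; have : (size C <= size S)%N.
    apply: uniq_leq_size => // y yC; apply/negPn/negP => yS.
    by apply: N; exists y.
  rewrite sC size_image card_ffun !card_ord leq_exp2l ?prime_gt1 // leqNgt kr //.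
exists (fun i => oapp x y (unlift ord_max i)) => c cp.
rewrite big_ord_recr /= unlift_none /=.
have -> : \sum_(i < k) (c (widen_ord (leqnSn k) i))%:R *
     oapp x y (unlift ord_max (widen_ord (leqnSn k) i)) =
   \sum_(i < k) (c (lift ord_max i))%:R * x i.
  apply: eq_bigr => i _.
  have -> : widen_ord (leqnSn k) i = lift ord_max i by apply: val_inj; rewrite /= /bump leqNgt ltn_ord.
  by rewrite liftK.
move=> e; have c0 : c ord_max = 0%N.
  apply/eqP/negPn/negP; rewrite -lt0n => cm.
  have [|m em] := @natr_inv_modp (c ord_max); first by rewrite cm cp.
  have [e' ee'] := Fp_combP x (fun i => (m * c (lift ord_max i))%N).
  case/negP: yS; apply/imageP; exists e' => //; rewrite -ee'.
  under eq_bigr do rewrite natrM -mulrA.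
  rewrite -mulr_sumr; apply/eqP; rewrite -subr_eq0 -oppr_eq0 opprB; apply/eqP.
  by rewrite -[X in _ - X]mul1r -mulNr -em -mulrA -mulrDr e mulr0.
move: e; rewrite c0 mul0r addr0 => /fx h i.
case: (unliftP ord_max i) => [j|] -> //; apply: h => l; exact: cp.
Qed.

Lemma Fp_dim_seq (r : nat) : Fp_dim_ge K p r -> exists C : seq K, uniq C /\ size C = (p ^ r)%N.
Proof.
move=> [x fx]; exists [seq Fp_comb x c | c : {ffun 'I_r -> 'I_p}].
rewrite size_image card_ffun !card_ord; split=> //.
rewrite /image_mem map_inj_uniq ?enum_uniq // => c c' e.
(* The difference of coefficients is taken modulo [p] in [nat], since [Fp_free] tests natural
   coefficients below [p]. *)
pose dl i := ((c i + (p - c' i)) %% p)%N.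
have dlp i : (dl i < p)%N by rewrite ltn_pmod.
have edl i : (dl i)%:R = (c i)%:R - (c' i)%:R :> K.
  rewrite natr_modp natrD natrB ?(pcharf0 pK) ?sub0r // ltnW //.
have := fx dl dlp; rewrite (eq_bigr (fun i => (c i)%:R * x i - (c' i)%:R * x i)); last first.
  by move=> i _; rewrite edl mulrBl.
rewrite sumrB -[X in X - _]/(Fp_comb x c) e subrr => /(_ erefl) dl0.
apply/ffunP => i; apply: val_inj => /=.
have := dl0 i; rewrite /dl => /eqP h.
have : c i = c' i %[mod p].
  apply/eqP; rewrite -(eqn_modDr (p - c' i)) subnKC ?modnn //; exact: ltnW.
by rewrite !modn_small.
Qed.
End FpSpan.

Section Matrices.
Variable L : fieldType.

Lemma mulmx2E' (A B : 'M[L]_2) i j : (A *m B) i j = A i 0 * B 0 j + A i 1 * B 1 j.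
Proof. exact: mulmx2E. Qed.

Lemma unipmxE (v : L) : (unipmx v 0 0 = 1) * (unipmx v 0 1 = v) * (unipmx v 1 0 = 0) * (unipmx v 1 1 = 1).
Proof. by rewrite !mxE. Qed.

Lemma diagmxE (v : L) : (diagmx v 0 0 = v) * (diagmx v 0 1 = 0) * (diagmx v 1 0 = 0) * (diagmx v 1 1 = v^-1).
Proof. by rewrite !mxE. Qed.

Lemma unipmx0 : unipmx (0 : L) = 1%:M.
Proof. by apply: mx2_eq; rewrite !unipmxE mxE. Qed.

Lemma diagmx1 : diagmx (1 : L) = 1%:M.
Proof. by apply: mx2_eq; rewrite !diagmxE mxE ?invr1. Qed.

Lemma unipmxD (v w : L) : unipmx v *m unipmx w = unipmx (v + w).
Proof. by apply: mx2_eq; rewrite mulmx2E' !unipmxE; ring. Qed.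

Lemma unipmx_inj : injective (@unipmx L).
Proof. by move=> v w e; rewrite -(unipmxE v).1.1.2 e unipmxE. Qed.

Lemma diagmxM (v w : L) : diagmx v *m diagmx w = diagmx (v * w).
Proof. by apply: mx2_eq; rewrite mulmx2E' !diagmxE ?invfM; ring. Qed.

Lemma diag_unip (z v : L) : z != 0 -> diagmx z *m unipmx v = unipmx (z ^+ 2 * v) *m diagmx z.
Proof. by move=> z0; apply: mx2_eq; rewrite !mulmx2E' !diagmxE !unipmxE; field. Qed.
End Matrices.

Lemma affine_sub (F : fieldType) (a b a' b' t : F) : a * t + b = a' * t + b' ->
  (a - a') * t - (b' - b) = 0.
Proof. by move=> e; transitivity (a * t + b - (a' * t + b')); [ring|rewrite e subrr]. Qed.

Lemma affine_quad (F : fieldType) (a b m f c t y : F) : y * (m * t + f) = a * t + b ->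
  (y + c) * (m * (t + 1) + f) = a * (t + 1) + b ->
  (c * m ^+ 2) * t ^+ 2 + ((c * m ^+ 2 + c * f * m + c * f * m) - 0) * t
    - (a * f - b * m - c * f * m - c * f ^+ 2) = 0.
Proof.
move=> e1 e2.
transitivity ((a * t + b + c * (m * t + f)) * (m * (t + 1) + f) - (a * (t + 1) + b) * (m * t + f)).
  by ring.
by rewrite -e1 -e2; ring.
Qed.

Lemma solve_affine (F : fieldType) (y f c t b : F) : f != 0 -> y * f = c * f * t + b ->
  y = c * t + b / f.
Proof. by move=> f0 e; apply: (mulIf f0); rewrite e; field. Qed.

Lemma affine_comp (F : fieldType) (a b x y t : F) :
  a * (x * t + y) + b = a * x * t + (a * y + b).
Proof. by ring. Qed.

(** * Affine form of the action on a generator *)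

Section Forward.
Variables (K : fieldType) (gT : finGroupType) (G : {group gT}) (d : nat).
Variable rG : mx_representation K G d.
Local Notation ga := (Defs.gact rG).
Local Notation cK := (@cKV K d).
Variables (t : KV K d) (w : gT).
Hypotheses (gt : generator rG t) (Gw : w \in G) (wt : ga w t = t + 1).

Let tt : transc cK t. Proof. by case: gt. Qed.

Lemma ga_affine g a b x : g \in G -> ga g (cK a * x + cK b) = cK a * ga g x + cK b.
Proof.
move=> Gg; have [s es] := gact_rm rG Gg.
by rewrite -!es rmorphD rmorphM !es !gactC.
Qed.

Lemma generator_inj g h : g \in G -> h \in G -> ga g t = ga h t -> g = h.
Proof.
move=> Gg Gh e; have [_ _ tf] := gt; apply/eqP; rewrite eq_mulgV1; apply/eqP.
apply: tf; first by rewrite groupM ?groupV.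
rewrite -(gactKVM rG t (groupVr Gh) Gg) e (gactKVM rG t (groupVr Gh) Gh).
by rewrite mulgV gactKV1.
Qed.

Lemma affine_inj a b a' b' : cK a * t + cK b = cK a' * t + cK b' -> a = a' /\ b = b'.
Proof.
move=> e; have h : cK (a - a') * t - cK (b' - b) = 0.
  by rewrite !rmorphB; exact: affine_sub e.
have ea : a = a' by apply/eqP; rewrite -subr_eq0; apply/eqP; apply: transc_lin h.
split=> //; move: e; rewrite ea => /addrI; exact: fmorph_inj.
Qed.

(* [M(t + 1) = M(t) + c] forces the Moebius transformation [M] to be affine with slope [c]. *)
Lemma normalizing_affine g h c : g \in G -> h \in G -> (g * w = h * g)%g ->
  ga h t = t + cK c -> exists b, ga g t = cK c * t + cK b.
Proof.
move=> Gg Gh e ht.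
have [a [b [m [f [n0 em]]]]] := generator_mobius gt Gg.
have [s es] := gact_rm rG Gw.
have sK k : s (cK k) = cK k by rewrite es gactC.
have eM : ga w (ga g t) = ga g t + cK c.
  rewrite gactKVM // e -gactKVM // ht.
  have [s' es'] := gact_rm rG Gg.
  by rewrite -!es' rmorphD !es' gactC.
have n1 : cK m * (t + 1) + cK f != 0.
  by have := n0; rewrite -(fmorph_eq0 s) rmorphD rmorphM !sK es wt.
have em1 : (ga g t + cK c) * (cK m * (t + 1) + cK f) = cK a * (t + 1) + cK b.
  by have := congr1 s em; rewrite (rmorphM s) !es !ga_affine // wt eM.
have c0 : c != 0.
  apply/eqP => c0; have h1 : h = 1%g.
    by have [_ _ tf] := gt; apply: tf => //; rewrite ht c0 rmorph0 addr0.
  have w1 : w = 1%g by apply: (mulgI g); rewrite e h1 mul1g mulg1.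
  move: wt; rewrite w1 gactKV1 => /eqP; rewrite -subr_eq0 opprD addNKr oppr_eq0 oner_eq0 //.
have q := affine_quad em em1.
have [q1 q2 _] : [/\ c * m ^+ 2 = 0, a * f - b * m - c * f * m - c * f ^+ 2 = 0
    & c * m ^+ 2 + c * f * m + c * f * m = 0].
  by apply: (transc_quad tt); rewrite !(rmorphB, rmorphD, rmorphM, rmorphXn, rmorph0).
have m0 : m = 0.
  by move/eqP: q1; rewrite mulf_eq0 (negbTE c0) expf_eq0 => /eqP.
move: em n0 q2; rewrite m0 rmorph0 mul0r add0r !mulr0 !subr0 => em n0 q2.
have f0 : f != 0 by rewrite -(fmorph_eq0 cK).
have ea : a = c * f.
  by apply: (mulIf f0); apply/eqP; rewrite -subr_eq0 -q2 -mulrA -expr2 //; apply/eqP; ring.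
exists (b / f); rewrite fmorph_div; apply: solve_affine => //.
by rewrite em ea rmorphM.
Qed.

Lemma affine_exp g a b k : g \in G -> ga g t = cK a * t + cK b ->
  exists b', ga (g ^+ k)%g t = cK (a ^+ k) * t + cK b'.
Proof.
move=> Gg e; elim: k => [|k [b' IH]].
  by exists 0; rewrite expg0 gactKV1 expr0 rmorph1 rmorph0 mul1r addr0.
exists (a * b' + b); rewrite expgS -gactKVM ?groupX //.
rewrite e ga_affine ?groupX // IH exprS (rmorphD cK) !(rmorphM cK).
exact: affine_comp.
Qed.
Lemma translation_exp g b k : g \in G -> ga g t = t + cK b ->
  ga (g ^+ k)%g t = t + cK (b *+ k).
Proof.
move=> Gg e; elim: k => [|k IH]; first by rewrite expg0 gactKV1 mulr0n rmorph0 addr0.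
rewrite expgS -gactKVM ?groupX //.
have [s es] := gact_rm rG (groupX k Gg).
by rewrite e -es rmorphD !es gactC ?groupX // IH mulrSr (rmorphD cK) addrA.
Qed.
End Forward.

Section GroupStructure.
Variables (gT : finGroupType) (G : {group gT}) (p n r : nat).
Variables (L : closedFieldType) (z : L) (V : seq L) (f : gT -> 'M[L]_2).
Hypotheses (pL : p \in [pchar L]) (zn : n.-primitive_root z).
Hypotheses (uV : uniq V) (V0 : 0 \in V)
  (Vz : {in V, forall a, z ^+ 2 * a \in V}) (sV : size V = (p ^ r)%N).
Hypotheses (f_inj : {in G &, injective f})
  (fM : forall x y, x \in G -> y \in G -> f (x * y)%g = f x *m f y).
Hypotheses (fV : forall v, v \in V -> exists2 x, x \in G & f x = unipmx v).

Lemma image1 : f 1%g = 1%:M.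
Proof.
have [x Gx] := fV V0; rewrite unipmx0 => fx.
suff -> : 1%g = x by [].
apply: (mulgI x); rewrite mulg1; apply: f_inj => //; first by rewrite groupM.
by rewrite fM // fx mulmx1.
Qed.

Lemma fX_unip x v k : x \in G -> f x = unipmx v -> f (x ^+ k)%g = unipmx (v *+ k).
Proof.
move=> Gx fx; elim: k => [|k IH]; first by rewrite expg0 image1 mulr0n unipmx0.
by rewrite expgS fM ?groupX // fx IH unipmxD mulrS.
Qed.

Lemma fX_diag x y k : x \in G -> f x = diagmx y -> f (x ^+ k)%g = diagmx (y ^+ k).
Proof.
move=> Gx fx; elim: k => [|k IH]; first by rewrite expg0 image1 expr0 diagmx1.
by rewrite expgS fM ?groupX // fx IH diagmxM exprS.
Qed.

Lemma diagmx_eq1 (y : L) : diagmx y = 1%:M -> y = 1.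
Proof. by move=> e; rewrite -(diagmxE y).1.1.1 e mxE. Qed.

Variables (K : fieldType) (tau : gT).
Hypotheses (pK : p \in [pchar K]) (r_gt0 : (0 < r)%N) (pn : ~~ (p %| n)%N).
Hypotheses (Gtau : tau \in G) (ftau : f tau = diagmx z).
Hypothesis ed1 : forall (d : nat) (rG : mx_representation K G d), mx_faithful rG -> ed_eq rG 1.

Lemma forward_main : [/\ odd n, exists x : K, n.-primitive_root x & Fp_dim_ge K p r].
Proof.
have p_pr : prime p by case/andP: pK.
have n0 : (0 < n)%N by apply: prim_order_gt0 zn.
have z0 : z != 0.
  apply/eqP => e; have := prim_expr_order zn.
  by rewrite e expr0n gtn_eqF // => /eqP; rewrite eq_sym oner_eq0.
have [v0 v0V v0n] : exists2 v, v \in V & v != 0.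
  apply: NNPP => N; have : (size V <= size [:: (0 : L)%R])%N.
    apply: uniq_leq_size => // v vV; rewrite inE; apply/negPn/negP => vn.
    by apply: N; exists v.
  by rewrite sV /= leqNgt -{1}(expn0 p) ltn_exp2l ?prime_gt1 // r_gt0.
have [w Gw fw] := fV v0V.
have up x v : x \in G -> f x = unipmx v -> (x ^+ p = 1)%g.
  move=> Gx fx; apply: f_inj; rewrite ?groupX //.
  by rewrite (fX_unip _ Gx fx) -mulr_natr (pcharf0 pL) mulr0 unipmx0 image1.
have wp := up _ _ Gw fw.
have w1 : w != 1%g.
  apply: contraNneq v0n => e; move: fw; rewrite e image1 -unipmx0 => /unipmx_inj <- //.
have [d [rG [fG tG]]] := exists_trig_repr pK Gw wp.
have [[E fE tE] _] := ed1 fG.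
have nG : G :!=: 1%g by apply/trivgPn; exists w.
have [t0 gt0] := exists_gen fE tE nG.
have [t [gt wt]] := unipotent_gen pK Gw wp w1 gt0 (norm_pth_of_trig Gw tG).
have tt : transc (@cKV K d) t by case: gt.
have wt' : Defs.gact rG w t = t + cKV K d 1 by rewrite rmorph1.
have cong g v : g \in G -> f g *m unipmx v0 = unipmx v *m f g -> v \in V ->
    forall h, h \in G -> f h = unipmx v -> (g * w = h * g)%g.
  move=> Gg e vV h Gh fh; apply: f_inj; rewrite ?groupM //.
  by rewrite !fM // fw fh.
have aff_comm g : g \in G -> f g *m unipmx v0 = unipmx v0 *m f g ->
    exists b, Defs.gact rG g t = cKV K d 1 * t + cKV K d b.
  move=> Gg e; apply: (normalizing_affine gt Gw wt Gg Gw _ wt').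
  exact: (cong g v0 Gg e v0V w Gw fw).
have unip_comm v v' : unipmx v *m unipmx v' = unipmx v' *m unipmx v :> 'M[L]_2.
  by rewrite !unipmxD addrC.
have Hc (v : seq_sub V) : exists cx : K * gT, [/\ cx.2 \in G, f cx.2 = unipmx (val v) &
    Defs.gact rG cx.2 t = t + cKV K d cx.1].
  have [x Gx fx] := fV (valP v).
  have [b eb] : exists b, Defs.gact rG x t = cKV K d 1 * t + cKV K d b.
    by apply: aff_comm => //; rewrite fx unip_comm.
  by exists (b, x); rewrite eb rmorph1 mul1r.
have [X hX] := fin_all_exists Hc.
have dimK : Fp_dim_ge K p r.
  apply: (@Fp_dim_of_seq K p pK r [seq (X v).1 | v : seq_sub V]).
    rewrite /image_mem map_inj_uniq ?enum_uniq // => v v' e.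
    have [G1 f1' a1] := hX v; have [G2 f2 a2] := hX v'.
    have exx : (X v).2 = (X v').2 by apply: (generator_inj gt G1 G2); rewrite a1 a2 e.
    by apply: val_inj; apply: unipmx_inj; rewrite -f1' -f2 exx.
  by rewrite size_image card_seq_sub // sV.
have zv0 : z ^+ 2 * v0 \in V by apply: Vz.
(* Conjugation by [tau] takes [w] to the element of [z^2 v0]; the slope [c] of [tau] is the amount
   by which that element translates. *)
have [c [b etau]] : exists c b, Defs.gact rG tau t = cKV K d c * t + cKV K d b.
  have [Gh fh ah] := hX (SeqSub zv0).
  exists (X (SeqSub zv0)).1.
  apply: (normalizing_affine gt Gw wt Gtau Gh _ ah).
  apply: (cong tau _ Gtau _ zv0 _ Gh fh).
  by rewrite ftau diag_unip.
have tau_exp k : (tau ^+ k = 1)%g -> (n %| k)%N.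
  move=> e; rewrite (prim_order_dvd zn); apply/eqP; apply: diagmx_eq1.
  by rewrite -(fX_diag _ Gtau ftau) e image1.
have tau_aff k : exists b', Defs.gact rG (tau ^+ k)%g t = cKV K d (c ^+ k) * t + cKV K d b'.
  exact: (affine_exp _ Gtau etau).
(* If [c^k = 1] then [tau^k] acts as a translation, whose [p]-th power is trivial; so [n] divides
   [k p], hence [k]. *)
have c_exp k : c ^+ k = 1 -> (n %| k)%N.
  move=> ck; have [b' eb] := tau_aff k.
  rewrite ck in eb.
  have eb2 : Defs.gact rG ((tau ^+ k) ^+ p)%g t = t + cKV K d (b' *+ p).
    by apply: translation_exp; [rewrite groupX|rewrite eb rmorph1 mul1r].
  have : ((tau ^+ k) ^+ p = 1)%g.
    have [_ _ tf] := gt; apply: tf; first by rewrite !groupX.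
    by rewrite eb2 -mulr_natr (pcharf0 pK) mulr0 rmorph0 addr0.
  rewrite -expgM => /tau_exp; rewrite Gauss_dvdl // coprime_sym prime_coprime //.
have cn : c ^+ n = 1.
  have [b' eb] := tau_aff n.
  have tn : (tau ^+ n = 1)%g.
    apply: f_inj; rewrite ?groupX // (fX_diag _ Gtau ftau) image1.
    by rewrite (prim_expr_order zn) diagmx1.
  move: eb; rewrite tn gactKV1 => eb.
  have eb' : cKV K d 1 * t + cKV K d 0 = cKV K d (c ^+ n) * t + cKV K d b'.
    by rewrite rmorph1 rmorph0 mul1r addr0.
  by have [<- _] := affine_inj gt eb'.
have cprim : n.-primitive_root c.
  have [m pm mn] := prim_order_exists n0 cn.
  have nm : (n %| m)%N by apply: c_exp; apply: prim_expr_order.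
  by have /eqP <- : m == n by rewrite eqn_dvd mn.
split=> //; last by exists c.
apply/negPn/negP => en.
have [k ek] : exists k, n = k.*2 by exists n./2; rewrite -[LHS]odd_double_half (negbTE en).
have k0 : (0 < k)%N by rewrite -double_gt0 -ek.
have [b1 e1] : exists b, Defs.gact rG (tau ^+ k)%g t = cKV K d 1 * t + cKV K d b.
  apply: aff_comm; first by rewrite groupX.
  rewrite (fX_diag _ Gtau ftau) diag_unip ?expf_neq0 // -exprM muln2 -ek.
  by rewrite (prim_expr_order zn) mul1r.
have [b2 e2] := tau_aff k.
have ck : c ^+ k = 1.
  by have [] := affine_inj gt (etrans (esym e2) e1).
have := dvdn_leq k0 (c_exp k ck).
by rewrite ek -addnn leqNgt -{1}[k]addn0 ltn_add2l k0.
Qed.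
End GroupStructure.

(** * Sufficiency of the conditions *)

Section TrdegRatgen.
Variables (K F : fieldType) (c : {rmorphism K -> F}).

Lemma kernel_vector m n (A : 'M[K]_(m, n)) : (n < m)%N -> exists2 u : 'rV_m, u != 0 & u *m A = 0.
Proof.
move=> nm; have : kermx A != 0.
  rewrite kermx_eq0 /row_free; apply: contraTneq nm => e.
  by rewrite -leqNgt -e rank_leq_col.
by case/rowV0Pn => u /sub_kermxP uA u0; exists u.
Qed.

Lemma quot_clear2 (x y x' y' : F) i j N : (i <= N)%N -> (j <= N)%N -> y != 0 -> y' != 0 ->
  (x / y) ^+ i * (x' / y') ^+ j * (y * y') ^+ N = x ^+ i * y ^+ (N - i) * (x' ^+ j * y' ^+ (N - j)).
Proof.
move=> iN jN y0 y0'; rewrite -(expr_div_clear x iN y0) -(expr_div_clear x' jN y0') [(y * y') ^+ N]exprMn.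
exact: mulrACA.
Qed.

Definition mon2 (i j : nat) : 'X_{1..2} := (U_(ord0) *+ i + U_(ord_max) *+ j)%MM.

Lemma mon2_inj i j i' j' : mon2 i j = mon2 i' j' -> i = i' /\ j = j'.
Proof.
move=> /mnmP h; have := h ord0; have := h ord_max.
by rewrite /mon2 !mnmDE !mulmnE !mnm1E /= !mul0n !mul1n !add0n !addn0.
Qed.

(* Dimension count: with [N = 2 D], there are [(N + 1)^2] monomials [e_0^i e_1^j], [i, j <= N], and
   after clearing denominators they lie in a space of dimension [2 N D + 1]. *)
Lemma ratgen_dep (f : F) (e : 'I_2 -> F) : (forall i, ratgen c f (e i)) ->
  exists2 Q : {mpoly K[2]}, Q != 0 & mmap c e Q = 0.
Proof.
move=> he; have [u0 [v0 [n0 e0]]] := he ord0; have [u1 [v1 [n1 e1]]] := he ord_max.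
(* There are [(2 D + 1)^2] monomials against the dimension [W = 4 D^2 + 1]; the successor keeps [D]
   positive, which makes the inequality strict. *)
pose D := (size u0 + size v0 + size u1 + size v1).+1.
pose N := (2 * D)%N; pose W := (2 * N * D).+1.
pose T := ('I_N.+1 * 'I_N.+1)%type.
pose P (l : T) := u0 ^+ l.1 * v0 ^+ (N - l.1) * (u1 ^+ l.2 * v1 ^+ (N - l.2)).
have sPow (q : {poly K}) k : (size q <= D.+1)%N -> (size (q ^+ k) <= (k * D).+1)%N.
  move=> sq; apply: leq_trans (size_poly_exp_leq _ _) _.
  by rewrite ltnS mulnC leq_mul2l; apply/orP; right; lia.
have sP l : (size (P l) <= W)%N.
  have i1 : (l.1 <= N)%N by rewrite -ltnS.
  have i2 : (l.2 <= N)%N by rewrite -ltnS.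
  have s1 := sPow u0 l.1; have s2 := sPow v0 (N - l.1)%N.
  have s3 := sPow u1 l.2; have s4 := sPow v1 (N - l.2)%N.
  have := size_polyMleq (u0 ^+ l.1 * v0 ^+ (N - l.1)) (u1 ^+ l.2 * v1 ^+ (N - l.2)).
  have := size_polyMleq (u0 ^+ l.1) (v0 ^+ (N - l.1)).
  have := size_polyMleq (u1 ^+ l.2) (v1 ^+ (N - l.2)).
  have := s1 ltac:(rewrite /D; lia); have := s2 ltac:(rewrite /D; lia).
  have := s3 ltac:(rewrite /D; lia); have := s4 ltac:(rewrite /D; lia).
  rewrite /P /W => a1 a2 a3 a4 b1 b2 b3.
  have m1 : (l.1 * D + (N - l.1) * D = N * D)%N by rewrite -mulnDl subnKC.
  have m2 : (l.2 * D + (N - l.2) * D = N * D)%N by rewrite -mulnDl subnKC.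
  lia.
have [a a0 ea] : exists2 a : 'rV_#|{: T}|, a != 0 &
    a *m \matrix_(l < #|{: T}|) (poly_rV (P (enum_val l)) : 'rV_W) = 0.
  apply: kernel_vector; rewrite card_prod !card_ord /W /N /D; nia.
have eP : \sum_(l < #|{: T}|) a 0 l *: P (enum_val l) = 0.
  apply/polyP => i; rewrite coef0 coef_sum.
  have [iW|Wi] := ltnP i W; last first.
    by rewrite big1 // => l _; rewrite coefZ nth_default ?mulr0 // (leq_trans (sP _)).
  have := congr1 (fun M : 'rV_W => M 0 (Ordinal iW)) ea; rewrite mxE [RHS]mxE => h.
  by rewrite -[RHS]h; apply: eq_bigr => l _; rewrite coefZ !mxE.
exists (\sum_(l < #|{: T}|) a 0 l *: 'X_[mon2 (enum_val l).1 (enum_val l).2]).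
  have [l0 nl0] : exists l, a 0 l != 0.
    apply: NNPP => H; case/eqP: a0; apply/rowP => l; rewrite mxE.
    by apply/eqP/negPn/negP => h; apply: H; exists l.
  apply: contraNneq nl0 => /(congr1 (fun q : {mpoly K[2]} => q@_(mon2 (enum_val l0).1 (enum_val l0).2))).
  rewrite raddf_sum /= (bigD1 l0) //= mcoeffZ mcoeffX eqxx mulr1 mcoeff0 big1 ?addr0 => [->//|l nl].
  rewrite mcoeffZ mcoeffX; case: eqP => [/mon2_inj [h1 h2]|_]; last by rewrite mulr0.
  case/eqP: nl; apply: enum_val_inj; move: h1 h2.
  by case: (enum_val l) => i j; case: (enum_val l0) => i' j' /= /val_inj -> /val_inj ->.
have vN0 : ((map_poly c v0).[f] * (map_poly c v1).[f]) ^+ N != 0 by rewrite expf_neq0 // mulf_neq0.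
apply: (mulIf vN0); rewrite mul0r raddf_sum mulr_suml.
transitivity ((map_poly c (\sum_(l < #|{: T}|) a 0 l *: P (enum_val l))).[f]); last first.
  by rewrite eP rmorph0 horner0.
rewrite rmorph_sum horner_sum; apply: eq_bigr => l _.
rewrite /= mmapZ mmapX map_polyZ hornerZ -mulrA; congr (_ * _).
have -> : mmap1 e (mon2 (enum_val l).1 (enum_val l).2) = e ord0 ^+ (enum_val l).1 * e ord_max ^+ (enum_val l).2.
  rewrite /mmap1 big_ord_recl big_ord1 /mon2 !mnmDE !mulmnE !mnm1E /=.
  rewrite !mul0n !mul1n !add0n !addn0; congr (_ * e _ ^+ _); apply: val_inj => //.
have i1 : ((enum_val l).1 <= N)%N by rewrite -ltnS.
have i2 : ((enum_val l).2 <= N)%N by rewrite -ltnS.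
rewrite e0 e1 quot_clear2 // /P !rmorphM /= !hornerM.
by rewrite !rmorphXn /= !horner_exp.
Qed.
End TrdegRatgen.

(** * Transport of a root of unity from [L] to [K] *)

Section Transport.
Variables (k L K : fieldType) (iL : {rmorphism k -> L}) (iK : {rmorphism k -> K}).
Variables (n : nat) (x : K) (a : L).
Hypotheses (xn : n.-primitive_root x) (an : a ^+ n = 1).

(** The gcd of [q] and a vanishing polynomial [m] of least degree does not vanish at [a], as [q]
    does not. So [m] divided by the gcd vanishes there, minimality makes the gcd constant, and
    Bezout gives the inverse. *)
Lemma alg_inv q : (exists2 P : {poly k}, P != 0 & (map_poly iL P).[a] = 0) ->
  (map_poly iL q).[a] <> 0 -> exists v, (map_poly iL v).[a] * (map_poly iL q).[a] = 1.
Proof.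
move=> [P P0 Pa] qa.
have [m [m0 ma] mm] := @min_measure {poly k} (fun q => size q)
  (fun q => q != 0 /\ (map_poly iL q).[a] = 0) (ex_intro _ P (conj P0 Pa)).
pose g := gcdp m q; have eg : m = (m %/ g) * g by rewrite divpK // dvdp_gcdl.
have g0 : g != 0 by rewrite gcdp_eq0 negb_and m0.
have h : (map_poly iL (m %/ g)).[a] = 0.
  move: ma; rewrite {1}eg rmorphM hornerM => /eqP; rewrite mulf_eq0 => /orP[] /eqP // ga0.
  case: qa; have /dvdpP [w ->] : g %| q by apply: dvdp_gcdr.
  by rewrite rmorphM hornerM ga0 mulr0.
have h0 : m %/ g != 0 by apply: contraNneq m0 => h0; rewrite eg h0 mul0r.
have := mm _ (conj h0 h); rewrite size_divp // => le.
have sg : size g = 1%N.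
  have : (0 < size g)%N by rewrite size_poly_gt0.
  have : (0 < size m)%N by rewrite size_poly_gt0.
  by move: le; case: (size g) => [|[|s]] //=; rewrite leqNgt ltn_subrL /= => /negP h' /h'.
have /Bezout_eq1_coprimepP [[u v] /= uv] : coprimep m q by rewrite /coprimep sg.
exists v; have := congr1 (fun p : {poly k} => (map_poly iL p).[a]) uv.
by rewrite rmorphD !rmorphM rmorph1 /= hornerD !hornerM ma mulr0 add0r hornerC.
Qed.

(* The minimal polynomial of [a] divides [X^n - 1], which splits over [K]. *)
Lemma transport_root : exists y : K, y ^+ n = 1 /\ forall q : {poly k},
  (map_poly iL q).[a] = 0 <-> (map_poly iK q).[y] = 0.
Proof.
have n0 := prim_order_gt0 xn.
pose P : {poly k} := 'X^n - 1.
have Pa : (map_poly iL P).[a] = 0.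
  by rewrite rmorphB rmorph1 /= map_polyXn hornerD hornerN hornerXn hornerC an subrr.
have P0 : P != 0 by rewrite -size_poly_eq0 size_XnsubC.
have [m [m0 ma] mm] := @min_measure {poly k} (fun q => size q)
  (fun q => q != 0 /\ (map_poly iL q).[a] = 0) (ex_intro _ P (conj P0 Pa)).
have mdvd q : (map_poly iL q).[a] = 0 -> m %| q.
  move=> qa; rewrite /dvdp; apply/negPn/negP => r0.
  have ra : (map_poly iL (q %% m)).[a] = 0.
    by move: qa; rewrite {1}(divp_eq q m) rmorphD rmorphM /= hornerD hornerM ma mulr0 add0r.
  by have := mm _ (conj r0 ra); rewrite leqNgt ltn_modp m0.
have sm : size m != 1%N.
  apply/negP => /size_poly1P [c c0 em]; move: ma; rewrite em map_polyC hornerC => /eqP.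
  by rewrite fmorph_eq0 (negbTE c0).
have : map_poly iK m %| map_poly iK P by rewrite dvdp_map; apply: mdvd.
have -> : map_poly iK P = \prod_(z <- [seq x ^+ i | i <- index_iota 0 n]) ('X - z%:P).
  by rewrite big_map (factor_Xn_sub_1 xn) rmorphB rmorph1 /= map_polyXn.
move=> dv; have [y yz ym] : exists2 y, y \in [seq x ^+ i | i <- index_iota 0 n] & root (map_poly iK m) y.
  have [msk em] := dvdp_prod_XsubC dv.
  case es : (mask msk _) em => [|y s] em.
    by move: em => /eqp_size; rewrite big_nil size_map_poly size_poly1 => e; rewrite e in sm.
  exists y; first by apply: (mem_mask (m := msk)); rewrite es mem_head.
  by rewrite (eqp_root em) root_prod_XsubC mem_head.
exists y; split.
  move/mapP: yz => [i _ ->]; rewrite exprAC (prim_expr_order xn) expr1n //.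
move=> q; split=> [qa|qy].
  have /dvdpP [h ->] := mdvd q qa.
  by rewrite rmorphM /= hornerM (rootP ym) mulr0.
(* If [q(a)] were nonzero it would have an inverse [v(a)]; then [m] would divide [v q - 1], whose
   value at the root [y] of [m] is -1. *)
apply: NNPP => qa.
have [v va] := alg_inv (ex_intro2 _ _ P P0 Pa) qa.
have : m %| v * q - 1.
  by apply: mdvd; rewrite rmorphB rmorphM rmorph1 hornerD hornerN hornerM va hornerC subrr.
move=> /dvdpP [h eh]; have := congr1 (fun p : {poly k} => (map_poly iK p).[y]) eh.
rewrite rmorphB !rmorphM rmorph1 /= hornerD hornerN !hornerM (rootP ym) qy !mulr0 sub0r hornerC.
by move/eqP; rewrite oppr_eq0 oner_eq0.
Qed.
End Transport.

Lemma solve_inv (F : fieldType) (q' q b v : F) : q' * q = 1 -> b + q * v = 0 -> - (q' * b) = v.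
Proof.
move=> i e; have -> : b = - (q * v) by apply/eqP; rewrite -addr_eq0 e.
by rewrite mulrN opprK mulrA i mul1r.
Qed.

(** * Embedding of [V] in [K] *)

Section Embedding.
Variables (k L K : fieldType) (iL : {rmorphism k -> L}) (iK : {rmorphism k -> K}).
Variables (a : L) (y : K).
Hypothesis ay : forall q : {poly k}, (map_poly iL q).[a] = 0 <-> (map_poly iK q).[y] = 0.
Local Notation eL q := (map_poly iL q).[a].
Local Notation eK q := (map_poly iK q).[y].
Variables (V : seq L) (C : seq K).
Hypotheses (uV : uniq V) (uC : uniq C) (sVC : size V = size C).
Hypotheses (V0 : 0 \in V) (VD : {in V &, forall b c, b + c \in V})
  (Vq : forall q b, b \in V -> eL q * b \in V).
Hypothesis invq : forall q, eL q <> 0 -> exists q', eL q' * eL q = 1 /\ eK q' * eK q = 1.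

(* Graph of an injective partial [k[X]]-linear map from [V] to [K]. *)
Record graph (J : L -> K -> Prop) : Prop := Graph {
  graph0 : J 0 0;
  graphD : forall b c b' c', J b c -> J b' c' -> J (b + b') (c + c');
  graphM : forall q b c, J b c -> J (eL q * b) (eK q * c);
  graph_fun : forall c, J 0 c -> c = 0;
  graph_inj : forall b, J b 0 -> b = 0;
  graph_dom : forall b c, J b c -> b \in V }.

Lemma evC (F : fieldType) (i : {rmorphism k -> F}) (z : F) e : (map_poly i e%:P).[z] = i e.
Proof. by rewrite map_polyC hornerC. Qed.

Lemma graphN J b c : graph J -> J b c -> J (- b) (- c).
Proof.
move=> gJ h; have := graphM gJ (-1)%:P h.
by rewrite !evC !rmorphN !rmorph1 !mulN1r.
Qed.

Lemma graph_uniq J b c c' : graph J -> J b c -> J b c' -> c = c'.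
Proof.
move=> gJ h h'; apply/eqP; rewrite -subr_eq0; apply/eqP; apply: (graph_fun gJ).
by rewrite -(subrr b); apply: (graphD gJ) => //; apply: graphN.
Qed.

(** The only possible clash is a relation [b0 + q(a) v = 0] or [c0 + q(y) kp = 0]. If [q(a)] is
    nonzero, the simultaneous inverse from [invq] puts [v] in the domain or [kp] in the image of
    [J]; otherwise [q(a)] and [q(y)] vanish together. *)
Lemma graph_extend J v kp : graph J -> v \in V -> (forall c, ~ J v c) -> (forall b, ~ J b kp) ->
  graph (fun b c => exists b0 c0 q, [/\ J b0 c0, b = b0 + eL q * v & c = c0 + eK q * kp]).
Proof.
move=> gJ vV nv nk.
have inv0 q b0 c0 : J b0 c0 -> b0 + eL q * v = 0 \/ c0 + eK q * kp = 0 -> eL q = 0.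
  move=> h e; apply: NNPP => /invq [q' [i1 i2]].
  have h2 := graphN gJ (graphM gJ q' h).
  case: e => e.
    apply: (nv (- (eK q' * c0))); suff <- : - (eL q' * b0) = v by [].
    by apply: solve_inv i1 e.
  apply: (nk (- (eL q' * b0))); suff <- : - (eK q' * c0) = kp by [].
  by apply: solve_inv i2 e.
split.
- by exists 0, 0, 0; split; [exact: graph0| |]; rewrite rmorph0 horner0 mul0r addr0.
- move=> _ _ _ _ [b0 [c0 [q [h -> ->]]]] [b1 [c1 [q1 [h1 -> ->]]]].
  exists (b0 + b1), (c0 + c1), (q + q1); split; first exact: graphD.
    by rewrite rmorphD hornerD mulrDl addrACA.
  by rewrite rmorphD hornerD mulrDl addrACA.
- move=> q _ _ [b0 [c0 [q1 [h -> ->]]]].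
  exists (eL q * b0), (eK q * c0), (q * q1); split; first exact: graphM.
    by rewrite rmorphM hornerM mulrDr mulrA.
  by rewrite rmorphM hornerM mulrDr mulrA.
- move=> c [b0 [c0 [q [h /esym e ->]]]].
  have q0 := inv0 _ _ _ h (or_introl e); move: e; rewrite q0 mul0r addr0 => e.
  move: (proj1 (ay q) q0) => ->; rewrite mul0r addr0; apply: (graph_fun gJ); by rewrite -e.
- move=> b [b0 [c0 [q [h -> /esym e]]]].
  have q0 := inv0 _ _ _ h (or_intror e); rewrite q0 mul0r addr0.
  move: e; rewrite (proj1 (ay q) q0) mul0r addr0 => e; apply: (graph_inj gJ); by rewrite -e.
move=> b c [b0 [c0 [q [h -> _]]]]; apply: VD; first exact: (graph_dom gJ h).
exact: Vq.
Qed.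

(* A partial embedding defined on fewer than [size V] elements can be extended, because [C] is
   too large to be covered by its image. *)
Lemma total_graph : exists2 J, graph J & forall v, v \in V -> exists c, J v c.
Proof.
(* The induction counts elements of [V] in the domain rather than dimensions, which avoids bases. *)
suff H l : (l <= size V)%N -> exists J, graph J /\ exists s, [/\ uniq s, size s = l,
    {subset s <= V} & forall v, v \in s -> exists c, J v c].
  have [J [gJ [s [us ss sV Js]]]] := H _ (leqnn _); exists J => // v vV; apply: Js.
  by rewrite (uniq_min_size us sV _).2 // ss.
elim: l => [|l IH] lV.
  exists (fun b c => b = 0 /\ c = 0); split; last by exists [::]; split.
  split=> //; first by move=> b c b' c' [-> ->] [-> ->]; rewrite !addr0.
  - by move=> q b c [-> ->]; rewrite !mulr0.
  - by move=> c [].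
  - by move=> b [].
  by move=> b c [-> _].
have [J [gJ [s [us ss sV Js]]]] := IH (ltnW lV).
have [all|nall] := classic (forall v, v \in V -> exists c, J v c).
  exists J; split=> //; exists (take l.+1 V); split; first exact: take_uniq.
  - by rewrite size_takel.
  - by move=> v /mem_take.
  by move=> v /mem_take /all.
have [v [vV nv]] : exists v, v \in V /\ forall c, ~ J v c.
  apply: NNPP => N; apply: nall => v vV; apply: NNPP => N'; apply: N; exists v; split=> // c h.
  by apply: N'; exists c.
have [kp [kC nk]] : exists kp, kp \in C /\ forall b, ~ J b kp.
  apply: NNPP => N.
  have ex (c : seq_sub C) : exists b, J b (val c).
    apply: NNPP => N'; apply: N; exists (val c); split; first exact: valP.
    by move=> b h; apply: N'; exists b.
  have [h hh] := fin_all_exists ex.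
  have : (size [seq h c | c : seq_sub C] <= size (rem v V))%N.
    apply: uniq_leq_size.
      rewrite /image_mem map_inj_uniq ?enum_uniq // => c c' e; apply: val_inj.
      by apply: (graph_uniq gJ (hh c)); rewrite e.
    move=> _ /mapP [c _ ->]; rewrite (mem_rem_uniq _ uV) inE (graph_dom gJ (hh c)) andbT.
    by apply/eqP => e; apply: (nv (val c)); rewrite -e.
  rewrite size_image card_seq_sub // size_rem // sVC.
  by rewrite leqNgt ltn_predL -sVC; case: (V) vV.
exists (fun b c => exists b0 c0 q, [/\ J b0 c0, b = b0 + eL q * v & c = c0 + eK q * kp]).
split; first exact: graph_extend.
exists (v :: s); split=> /=.
- by rewrite us andbT; apply/negP => /Js [c /nv].
- by rewrite ss.
- by move=> b; rewrite inE => /orP[/eqP->|/sV].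
move=> b; rewrite inE => /orP[/eqP->|/Js [c h]].
  exists kp, 0, 0, 1; split; [exact: graph0| |]; by rewrite rmorph1 hornerC mul1r add0r.
by exists c, b, c, 0; rewrite !rmorph0 !horner0 !mul0r !addr0.
Qed.
End Embedding.

Lemma prime_field_embedding (F : fieldType) (p : nat) : p \in [pchar F] ->
  exists i : {rmorphism 'F_p -> F}, forall e : 'F_p, i e = (e : nat)%:R.
Proof.
move=> pF; pose i : {rmorphism 'F_p -> pPrimeCharType pF} := in_alg _.
by exists i => e; rewrite -{1}[e]natr_Zp rmorph_nat.
Qed.

Lemma affine_quot (F : fieldType) (S T a b : F) : T != 0 -> (a * S + b * T) / T = a * (S / T) + b.
Proof. by move=> T0; field. Qed.

Lemma distrib_mul (F : fieldType) (a b c X : F) : (a * b + c) * X = a * (b * X) + c * X.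
Proof. by ring. Qed.

Lemma affine_fix (F : fieldType) (a m x : F) : x = a * x + m -> (a - 1) * x - (- m) = 0.
Proof. by move=> e; transitivity (a * x + m - x); [ring|rewrite -e subrr]. Qed.

Section Cocycle.
Variables (K : fieldType) (gT : finGroupType) (G : {group gT}) (d : nat).
Variable rG : mx_representation K G d.
Local Notation ga := (Defs.gact rG).
Local Notation cK := (@cKV K d).
Hypothesis faithfulG : mx_faithful rG.
Variables (chi m : gT -> K).
Hypothesis mM : forall g h, g \in G -> h \in G -> m (g * h)%g = chi g * m h + m g.
Hypothesis faithful_cm : forall g, g \in G -> chi g = 1 -> m g = 0 -> g = 1%g.
Variable w : gT.
Hypotheses (Gw : w \in G) (w1 : w != 1%g) (chiw : chi w = 1).

(* The quotient of two Lagrange-type resolvents realizes the affine action [x |-> chi x + m]. *)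
Lemma affine_function : exists f, forall h, h \in G -> ga h f = cK (chi h) * f + cK (m h).
Proof.
have [x x0] := trace_neq0 faithfulG.
exists ((\sum_(g in G) cK (m g^-1%g) * ga g x) / (\sum_(g in G) ga g x)) => h Gh.
have [s es] := gact_rm rG Gh.
set T := \sum_(g in G) ga g x in x0 *.
set S := \sum_(g in G) _.
have eT : s T = T.
  rewrite rmorph_sum [RHS](reindex_inj (mulIg h)) /=.
  apply: eq_big => [g|g Gg]; first by rewrite groupMr.
  by rewrite es gactKVM.
have eS : s S = cK (chi h) * S + cK (m h) * T.
  rewrite rmorph_sum mulr_sumr [X in _ = _ + X]mulr_sumr -big_split /=.
  rewrite [RHS](reindex_inj (mulIg h)) /=.
  apply: eq_big => [g|g Gg]; first by rewrite groupMr.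
  rewrite rmorphM !es gactC // gactKVM //.
  (* Cocycle rule for the product of [h] and [(g h)^-1], which is [g^-1]. *)
  have -> : m g^-1%g = chi h * m (g * h)^-1%g + m h.
    by rewrite -mM ?groupV ?groupM // invMg mulgA mulgV mul1g.
  rewrite (rmorphD cK) (rmorphM cK); exact: distrib_mul.
rewrite -es fmorph_div eT eS.
exact: affine_quot.
Qed.
Lemma cocycle_ed1 : ed_eq rG 1.
Proof.
have nG : G :!=: 1%g by apply/trivgPn; exists w.
split; last by move=> E t fE tE; apply: (trdeg_ge1 nG fE tE).
have [f hf] := affine_function.
(* As [chi w = 1], a constant [f] would make [m w] vanish, and [w] would be trivial. *)
have nf k : f <> cK k.
  move=> fk; have := hf w Gw; rewrite chiw fk gactC // rmorph1 mul1r => /eqP.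
  rewrite -subr_eq0 opprD addNKr oppr_eq0 fmorph_eq0 => /eqP mw.
  by move: w1; rewrite (faithful_cm Gw chiw mw) eqxx.
have tf : transc cK f by apply: KV_transc.
exists (ratgen cK f).
  split.
  - have sr := ratgen_sub cK f; split.
    + by move=> k; apply: (ratgenC cK f k).
    + by move=> x y; apply: subD.
    + by move=> x; apply: subN.
    + by move=> x y; apply: (subM sr).
    by move=> x; apply: (subV sr).
  - move=> g x Gg h; have gx := ratgen_ga rG Gg h; apply: (ratgen_trans _ gx); rewrite hf //.
    apply: subD; [exact: ratgen_sub| |exact: ratgenC].
    by apply: (subM (ratgen_sub cK f)); [exact: ratgenC|exact: ratgen_self].
  move=> g Gg g1; exists f; first exact: ratgen_self.
  apply: contraNneq g1 => e; move: (hf g Gg); rewrite e => e1.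
  have l : cK (chi g - 1) * f - cK (- m g) = 0.
    by rewrite !(rmorphB cK) rmorph1 (rmorphN cK); exact: affine_fix e1.
  have c1 : chi g = 1 by apply/eqP; rewrite -subr_eq0; apply/eqP; apply: transc_lin l.
  apply/eqP; apply: faithful_cm => //.
  move: l; rewrite c1 subrr rmorph0 mul0r sub0r => /eqP.
  by rewrite oppr_eq0 fmorph_eq0 oppr_eq0 => /eqP.
by move=> e he; apply: (ratgen_dep he).
Qed.
End Cocycle.

Section Backward.
Variables (gT : finGroupType) (G : {group gT}) (p n r : nat).
Variables (L : closedFieldType) (z : L) (V : seq L) (f : gT -> 'M[L]_2).
Hypotheses (pL : p \in [pchar L]) (zn : n.-primitive_root z).
Hypotheses (uV : uniq V) (V0 : 0 \in V) (VD : {in V &, forall a b, a + b \in V})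
  (Vz : {in V, forall a, z ^+ 2 * a \in V}) (sV : size V = (p ^ r)%N).
Hypotheses (f_inj : {in G &, injective f})
  (fM : forall x y, x \in G -> y \in G -> f (x * y)%g = f x *m f y).
Hypotheses (fV : forall v, v \in V -> exists2 x, x \in G & f x = unipmx v).
Variable K : fieldType.
Hypotheses (pK : p \in [pchar K]) (r_gt0 : (0 < r)%N).
Hypothesis genG : (G :=: <<[set x in G | has (fun v => f x == unipmx v) V
                              || (f x == diagmx z)]>>)%g.
Variable x : K.
Hypotheses (on : odd n) (xn : n.-primitive_root x) (dimK : Fp_dim_ge K p r).

Let n_gt0 : (0 < n)%N. Proof. exact: prim_order_gt0 zn. Qed.
Let zX k : z ^+ 2 ^+ k = z ^+ k ^+ 2. Proof. by rewrite exprAC. Qed.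

Let z0 : z != 0.
Proof.
apply/eqP => e; have := prim_expr_order zn.
by rewrite e expr0n gtn_eqF // => /eqP; rewrite eq_sym oner_eq0.
Qed.

Lemma V_pow k v : v \in V -> z ^+ 2 ^+ k * v \in V.
Proof.
move=> vV; elim: k => [|k IH]; first by rewrite expr0 mul1r.
by rewrite exprS -mulrA; apply: Vz.
Qed.

(** The generators have this form, and products keep it by moving diagonal matrices to the right
    with [diag_unip]. *)
Lemma G_normal_form g : g \in G -> exists kv : nat * L,
  kv.2 \in V /\ f g = unipmx kv.2 *m diagmx (z ^+ kv.1).
Proof.
move=> Gg; pose good g := exists kv : nat * L, kv.2 \in V /\ f g = unipmx kv.2 *m diagmx (z ^+ kv.1).
have im1 := image1 V0 f_inj fM fV.
have : g \in <<[set x in G | has (fun v => f x == unipmx v) V || (f x == diagmx z)]>>%g.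
  by rewrite -genG.
case/gen_prodgP => l [c cS ->].
suff [] : (\prod_(i < l) c i)%g \in G /\ good (\prod_(i < l) c i)%g by [].
apply: (big_ind (fun g => g \in G /\ good g)).
- by split=> //; exists (0%N, 0); rewrite im1 /= unipmx0 expr0 diagmx1 mul1mx.
- move=> g1 g2 [G1 [[k1 v1] /= [V1 e1]]] [G2 [[k2 v2] /= [V2 e2]]]; split; first exact: groupM.
  exists ((k1 + k2)%N, v1 + z ^+ 2 ^+ k1 * v2) => /=; split; first by apply: VD => //; apply: V_pow.
  rewrite fM // e1 e2 -unipmxD exprD -diagmxM !mulmxA; congr (_ *m _).
  by rewrite -!mulmxA; congr (_ *m _); rewrite diag_unip ?expf_neq0 // -zX.
move=> i _; have := cS i; rewrite inE => /andP[Gi /orP[/hasP [v vV /eqP e]|/eqP e]]; split=> //.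
  by exists (0%N, v); rewrite /= expr0 diagmx1 mulmx1.
by exists (1%N, 0); rewrite /= expr1 unipmx0 mul1mx.
Qed.

Lemma normal_form_uniq (a a' v v' : L) : a != 0 -> a' != 0 ->
  unipmx v *m diagmx a = unipmx v' *m diagmx a' -> a = a' /\ v = v'.
Proof.
move=> a0 a0' e; have := congr1 (fun M : 'M[L]_2 => M 0 0) e.
have := congr1 (fun M : 'M[L]_2 => M 0 1) e.
rewrite !mulmx2E' !unipmxE !diagmxE !mul1r !mulr0 !add0r !addr0 => e1 e2.
split=> //; move: e1; rewrite e2 => /mulIf; apply; exact: invr_neq0.
Qed.

Lemma backward_main (d : nat) (rG : mx_representation K G d) : mx_faithful rG -> ed_eq rG 1.
Proof.
move=> fG.
have im1 := image1 V0 f_inj fM fV.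
have p_pr : prime p by case/andP: pK.
have [iL hL] := prime_field_embedding pL; have [iK hK] := prime_field_embedding pK.
have an : (z ^+ 2) ^+ n = 1 by rewrite exprAC (prim_expr_order zn) expr1n.
have [y [yn ay]] := transport_root iL iK xn an.
have [C [uC sC]] := Fp_dim_seq pK dimK.
have Vq q b : b \in V -> (map_poly iL q).[z ^+ 2] * b \in V.
  elim/poly_ind: q b => [|q c IH] b bV; first by rewrite rmorph0 horner0 mul0r.
  rewrite rmorphD rmorphM /= map_polyX map_polyC hornerD hornerMX hornerC mulrDl.
  apply: VD; first by rewrite -mulrA; apply: IH; apply: Vz.
  (* A scalar of the prime field acts as a natural multiple, so additive closure of [V] suffices. *)
  rewrite /= hL mulr_natl; elim: (nat_of_ord c) => [|l IHl]; first by rewrite mulr0n.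
  by rewrite mulrS; apply: VD.
have invq q : (map_poly iL q).[z ^+ 2] <> 0 -> exists q',
    (map_poly iL q').[z ^+ 2] * (map_poly iL q).[z ^+ 2] = 1 /\
    (map_poly iK q').[y] * (map_poly iK q).[y] = 1.
  move=> q0; have [|q' e] := alg_inv _ q0.
    exists ('X^n - 1); first by rewrite -size_poly_eq0 size_XnsubC.
    by rewrite rmorphB rmorph1 /= map_polyXn hornerD hornerN hornerXn hornerC an subrr.
  exists q'; split=> //; apply/eqP; rewrite -subr_eq0; apply/eqP.
  have := proj1 (ay (q' * q - 1)); rewrite !rmorphB !rmorphM !rmorph1 !hornerD !hornerN !hornerM !hornerC.
  by rewrite e subrr => /(_ erefl).
have sVC : size V = size C by rewrite sV sC.
have [J gJ Jt] := total_graph ay uV uC sVC V0 VD Vq invq.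
(* An exponent, a vector and its image in [K] are chosen for each [g]. The exponent is determined
   only modulo [n]; [zk] shows that the power of [y], used as [chi g], does not depend on the
   choice. *)
have H g : exists kvc : nat * L * K, g \in G -> [/\ kvc.1.2 \in V,
    f g = unipmx kvc.1.2 *m diagmx (z ^+ kvc.1.1) & J kvc.1.2 kvc.2].
  have [Gg|nGg] := boolP (g \in G); last by exists (0%N, 0, 0).
  have [[k v] /= [vV e]] := G_normal_form Gg; have [c Jc] := Jt v vV.
  by exists (k, v, c).
have [X hX] := fin_all_exists H.
have JX k v c : J v c -> J (z ^+ 2 ^+ k * v) (y ^+ k * c).
  by move/(graphM gJ 'X^k); rewrite !map_polyXn !hornerXn.
have zk k k' : z ^+ k = z ^+ k' -> y ^+ k = y ^+ k'.
  move=> e; have := proj1 (ay ('X^k - 'X^k')); rewrite !rmorphB /= !map_polyXn !hornerD !hornerN !hornerXn.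
  by rewrite !zX e subrr => /(_ erefl) /eqP; rewrite subr_eq0 => /eqP.
have [v0 v0V v0n] : exists2 v, v \in V & v != 0.
  apply: NNPP => N; have : (size V <= size [:: (0 : L)%R])%N.
    apply: uniq_leq_size => // v vV; rewrite inE; apply/negPn/negP => vn.
    by apply: N; exists v.
  by rewrite sV /= leqNgt -{1}(expn0 p) ltn_exp2l ?prime_gt1 // r_gt0.
have [w Gw fw] := fV v0V.
have w1 : w != 1%g.
  apply: contraNneq v0n => e; move: fw; rewrite e im1 -unipmx0 => /unipmx_inj <- //.
have chiw : y ^+ (X w).1.1 = 1.
  have [_ e _] := hX w Gw; rewrite -[RHS](expr0 y); apply: zk.
  have [] // := @normal_form_uniq (z ^+ (X w).1.1) (z ^+ 0) (X w).1.2 v0 _ _ _.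
  - exact: expf_neq0.
  - exact: expf_neq0.
  by rewrite -e fw expr0 diagmx1 mulmx1.
apply: (@cocycle_ed1 K gT G d rG fG (fun g => y ^+ (X g).1.1) (fun g => (X g).2) _ _ w Gw w1 chiw).
  move=> g h Gg Gh.
  have [vg eg Jg] := hX g Gg; have [vh eh Jh] := hX h Gh.
  have [vgh egh Jgh] := hX (g * h)%g (groupM Gg Gh).
  have [ek ev] : z ^+ (X (g * h)%g).1.1 = z ^+ ((X g).1.1 + (X h).1.1) /\
      (X (g * h)%g).1.2 = (X g).1.2 + z ^+ 2 ^+ (X g).1.1 * (X h).1.2.
    apply: normal_form_uniq; try exact: expf_neq0.
    rewrite -egh fM // eg eh -unipmxD exprD -diagmxM !mulmxA; congr (_ *m _).
    by rewrite -!mulmxA; congr (_ *m _); rewrite diag_unip ?expf_neq0 // -zX.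
  apply: (graph_uniq gJ Jgh); rewrite ev addrC; apply: (graphD gJ) => //.
  exact: JX.
move=> g Gg; have [vg eg Jg] := hX g Gg => c1 m1.
(* Oddness of [n] is used here: with [k] the exponent of [g], [chi g = 1] gives [z^(2 k) = 1], so
   [n] divides [2 k] and hence [k]. *)
have zk1 : z ^+ (X g).1.1 = 1.
  have := proj2 (ay ('X^((X g).1.1) - 1)); rewrite !rmorphB !rmorph1 /= !map_polyXn !hornerD !hornerN !hornerXn !hornerC.
  rewrite c1 subrr => /(_ erefl) /eqP; rewrite subr_eq0 zX => /eqP h2.
  apply/eqP; rewrite -(prim_order_dvd zn) -(@Gauss_dvdl _ _ 2) ?coprimen2 //.
  by rewrite (prim_order_dvd zn) exprM h2.
apply: f_inj => //; rewrite eg im1 zk1 diagmx1 mulmx1.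
by rewrite m1 in Jg; rewrite (graph_inj gJ Jg) unipmx0.
Qed.
End Backward.

Theorem theorem1p5 (p n r s : nat) (K : fieldType)
    (gT : finGroupType) (G : {group gT}) :
  p \in [pchar K] ->
  ~~ (p %| n)%N ->
  (0 < r)%N ->
  (* s = [F_p(zeta_n^2) : F_p], computed in an algebraically closed field of char p *)
  (exists (L : closedFieldType) (z : L),
      [/\ p \in [pchar L], n.-primitive_root z & Fp_degree p (z ^+ 2) s]) ->
  (s %| r)%N ->
  is_Gnpr G p n r ->
  ((forall (d : nat) (rG : mx_representation K G d), mx_faithful rG -> ed_eq rG 1)
   <-> [/\ odd n, exists x : K, n.-primitive_root x & Fp_dim_ge K p r]).
Proof.
move=> pK pn r_gt0 _ _ [L [z [V [f [pL zn [uV V0 VD Vz sV] [f_inj fM] [fV [[tau Gtau ftau] genG]]]]]]].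
split=> [ed1|[on [x xn] dimK] d rG fG].
  exact: (forward_main pL zn uV V0 Vz sV f_inj fM fV pK r_gt0 pn Gtau ftau ed1).
exact: (backward_main pL zn uV V0 VD Vz sV f_inj fM fV pK r_gt0 genG on xn dimK fG).
Qed.
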